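(* Let $d\ge1$, $T\ge1$, $K_t^j\subseteq\mathbb R$ closed, $K_t=\prod_{j=1}^dK_t^j$, $\Omega=K_0\times\dots\times K_T$. For $t=0,\dots,T$ let $\mathcal E_t\subseteq C_t$ be vector subspaces with $\mathcal E_t+\mathbb R=\mathcal E_t$ containing the coordinate maps $X_t$ ($x_t\mapsto x_t^j$), and let $S_t:\mathcal E_t\to\mathbb R$ be concave, cash additive ($S_t(\varphi_t+k)=S_t(\varphi_t)+k$, $k\in\mathbb R$) with $S_t(0)=0$. Set $\mathcal E=\mathcal E_0\times\dots\times\mathcal E_T$, $U(\varphi)=\sum_{t=0}^TS_t(\varphi_t)$, $V(\varphi)=-U(-\varphi)$, and suppose that for every $t$ there exist compact $\mathfrak K_t(n)\subseteq K_t$ and $0\le f_t^n\in\mathcal E_t$ ($n\ge1$) with $1+\sum_{t,j}|x_t^j|\le\sum_tf_t^n(x_t)$ for all $x\in\Omega\setminus(\mathfrak K_0(n)\times\dots\times\mathfrak K_T(n))$ and $V(\Gamma f_0^n,\dots,\Gamma f_T^n)\to0$ for every $\Gamma>0$. Let, for $Q_t\in\mathrm{Prob}^1(K_t)$, $\mathcal D_t(Q_t):=\sup_{\varphi_t\in\mathcal E_t}\big(S_t(\varphi_t)-\int_{K_t}\varphi_t\,dQ_t\big)$. Let $c:\Omega\to(-\infty,+\infty]$ be lower semicontinuous with $c(x)\ge-A(1+\sum_{t,j}|x_t^j|)$ for some $A\ge0$. Then $$\sup\Big\{\sum_{t=0}^TS_t(\varphi_t):\varphi\in\mathcal E,\ \exists\Delta\in\mathcal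 H\text{ with }\sum_{t=0}^T\varphi_t(x_t)+I^\Delta(x)\le c(x)\ \forall x\in\Omega\Big\}=\inf_{Q\in\mathrm{Mart}(\Omega)}\Big(E_Q[c]+\sum_{t=0}^T\mathcal D_t(Q_t)\Big),$$ and the infimum is a minimum provided the common value is $<+\infty$.
   Context: $C_t$ is the space of continuous $\phi:K_t\to\mathbb R$ with $\sup_{x_t}|\phi(x_t)|/(1+\sum_j|x_t^j|)<\infty$. $\mathrm{Prob}^1(K_t)$ (resp. $\mathrm{Prob}^1(\Omega)$): Borel probability measures integrating all $|x_t^j|$; $Q_t$ is the marginal of $Q$ on $K_t$. $\mathcal H$: $\Delta=(\Delta_0,\dots,\Delta_{T-1})$ with $\Delta_t\in(C_b(K_0\times\dots\times K_t))^d$; $I^\Delta(x)=\sum_{t=0}^{T-1}\sum_{j=1}^d\Delta_t^j(x_0,\dots,x_t)(x_{t+1}^j-x_t^j)$. $\mathrm{Mart}(\Omega)=\{Q\in\mathrm{Prob}^1(\Omega):E_Q[I^\Delta]=0\ \forall\Delta\in\mathcal H\}$. *)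

(* Defs.v *)
From HB Require Import structures.
From mathcomp Require Import all_boot all_order all_algebra.
From mathcomp Require Import all_classical all_reals all_analysis.
Set Implicit Arguments. Unset Strict Implicit. Unset Printing Implicit Defensive.
Import Order.TTheory GRing.Theory Num.Theory.
Import numFieldNormedType.Exports.
Local Open Scope classical_set_scope.
Local Open Scope ring_scope.

(* Points of R^d are row vectors 'rV[R]_d (coordinate j of v is v ord0 j);
   paths (x_0,...,x_T) are matrices 'M[R]_(T.+1, d) whose row t is x_t,
   so that x_t^j = x t j.
   Borel sigma-algebras: the sigma-algebras generated by the open sets. *)
Notation BorelRow R d := (g_sigma_algebraType (@open 'rV[R]_d)).
Notation BorelPath R d T := (g_sigma_algebraType (@open 'M[R]_(T.+1, d))).

Section defs.
Variables (R : realType) (d T : nat).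
Variable K : 'I_T.+1 -> 'I_d -> set R.

Definition Kt (t : 'I_T.+1) : set 'rV[R]_d := [set v | forall j, K t j (v ord0 j)].

Definition Omega : set 'M[R]_(T.+1, d) := [set x | forall t, Kt t (row t x)].

Definition Kpt (t : 'I_T.+1) := {v : 'rV[R]_d | Kt t v}.

(* extension by 0 outside A of a function defined on A (only used to
   express continuity on A and integrals over A) *)
Definition ext {X : Type} (A : set X) (phi : {v : X | A v} -> R) : X -> R :=
  fun v => match pselect (A v) with
           | left h => phi (exist _ v h)
           | right _ => 0
           end.

Definition inC (t : 'I_T.+1) (phi : Kpt t -> R) : Prop :=
  {within Kt t, continuous (ext phi)} /\
  exists M : R, forall v : Kpt t,
    `|phi v| <= M * (1 + \sum_(j < d) `|(sval v) ord0 j|).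

(* the set K_0 x ... x K_t (embedded in the path space: the remaining
   coordinates are free) *)
Definition Pre (t : 'I_T) : set 'M[R]_(T.+1, d) :=
  [set x | forall s : 'I_T.+1, (s <= t)%N -> Kt s (row s x)].

Definition inH (Delta : 'I_T -> 'M[R]_(T.+1, d) -> 'rV[R]_d) : Prop :=
  forall t : 'I_T,
    (forall x y : 'M[R]_(T.+1, d),
        (forall s : 'I_T.+1, (s <= t)%N -> row s x = row s y) ->
        Delta t x = Delta t y) /\
    {within Pre t, continuous (Delta t)} /\
    (exists M : R, forall x, Pre t x -> forall j, `|Delta t x ord0 j| <= M).

Definition IDelta (Delta : 'I_T -> 'M[R]_(T.+1, d) -> 'rV[R]_d)
  (x : 'M[R]_(T.+1, d)) : R :=
  \sum_(t < T) \sum_(j < d)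
     Delta t x ord0 j * (x (lift ord0 t) j - x (widen_ord (leqnSn T) t) j).

(* Prob^1(Omega): Borel probability measures on Omega (i.e. on the ambient
   path space, giving full mass to Omega) integrating every |x_t^j| *)
Definition Prob1 (Q : probability (BorelPath R d T) R) : Prop :=
  Q Omega = 1%E /\
  forall (t : 'I_T.+1) (j : 'I_d),
    Q.-integrable Omega (fun x : BorelPath R d T => (x t j)%:E).

Definition Mart (Q : probability (BorelPath R d T) R) : Prop :=
  Prob1 Q /\
  forall Delta, inH Delta ->
    (\int[Q]_(x in Omega) (IDelta Delta x)%:E = 0)%E.

Definition marginal (Q : probability (BorelPath R d T) R) (t : 'I_T.+1) :=
  pushforward Q (fun x : BorelPath R d T => (row t x : BorelRow R d)).

Definition Dt (E : forall t : 'I_T.+1, set (Kpt t -> R))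
  (S : forall t : 'I_T.+1, (Kpt t -> R) -> R)
  (t : 'I_T.+1) (Qt : set (BorelRow R d) -> \bar R) : \bar R :=
  ereal_sup [set ((S t phi)%:E - \int[Qt]_(v in Kt t) (ext phi v)%:E)%E
            | phi in E t].

Definition Ufun (S : forall t : 'I_T.+1, (Kpt t -> R) -> R)
  (phi : forall t : 'I_T.+1, Kpt t -> R) : R :=
  \sum_(t < T.+1) S t (phi t).

Definition Vfun (S : forall t : 'I_T.+1, (Kpt t -> R) -> R)
  (phi : forall t : 'I_T.+1, Kpt t -> R) : R :=
  - Ufun S (fun t v => - phi t v).

Definition lsc_on (A : set 'M[R]_(T.+1, d)) (c : 'M[R]_(T.+1, d) -> \bar R) :=
  forall x, A x -> forall a : R, (a%:E < c x)%E ->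
    exists2 V, nbhs x V & forall y, V y -> A y -> (a%:E < c y)%E.

End defs.

(* Main.v *)
Require Import Defs.
From HB Require Import structures.
From mathcomp Require Import all_boot all_order all_algebra.
From mathcomp Require Import all_classical all_reals all_analysis.
From mathcomp Require Import measurable_realfun ring lra.
Set Implicit Arguments. Unset Strict Implicit. Unset Printing Implicit Defensive.
Import Order.TTheory GRing.Theory Num.Theory.
Import numFieldNormedType.Exports.
Local Open Scope classical_set_scope.
Local Open Scope ring_scope.

(** Weak duality integrates the superhedging inequality against a martingale
measure.  For the converse let the primal value [p] be finite, and write
[C(Omega)] for the continuous functions of at most linear growth.  The set of
pairs [(h, r)] such that [r <= U(phi) - p] for some [phi], [Delta] with
[phi + I^Delta <= c + h] is convex, so Hahn-Banach yields a linear [L] on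
[C(Omega)] with [r <= L h] on it.  Monotonicity and cash additivity make [L]
positive and normalized, and [L] vanishes on every [I^Delta].  Testing with
[phi = - Gamma f^n] gives [L (sum_t f_t^n) -> 0]; with Dini's theorem on the
compact sets, [L] is then continuous along decreasing sequences, hence is
integration against a probability [Q] by the Daniell-Stone construction.
Finally [U(phi) - L(phi) + L(g) <= p] for all [g <= c] in [C(Omega)], and
letting [g] increase to [c] (inf-convolution) shows that [Q] is optimal.
Working with [p(c + h)] for the lower semicontinuous [c] itself avoids any
limit of measures. *)

(** * Hahn-Banach separation *)

(** Since [Omega] need not be compact, a positive functional on [C(Omega)] may carry mass at
    infinity, and bounding total mass alone would not control first moments. The functions [f^n]
    settle both: their sum dominates the weight [1 + sum |x_t^j|] off a compact set. They also
    provide, for every [h] in [C(Omega)], some hedge of [c + h], so the set of pairs lies over the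
    whole space. Whether the best hedge of [c + h] has finite value is not known in advance; hence
    the separation theorem is stated for a hypograph, given as a relation, and not for a concave
    function. The properties of [L] come from a single device: one fixed hedge, shifted by arbitrary
    multiples of a function, gives a lower bound on [k L(u)] that does not depend on [k], which
    forces a sign or a zero. The final inequality bounds a joint supremum over [phi]. As the
    components [phi_t] vary independently, it splits into the sum of the penalties. *)

Section hahn_banach.
Variables (R : realType) (V : lmodType R) (C : set V) (A : V -> R -> Prop).
Hypothesis Clin : forall a u v, C u -> C v -> C (a *: u + v).
Hypothesis Aconv : forall u v r s l, C u -> C v -> A u r -> A v s ->
  0 <= l <= 1 -> A (l *: u + (1 - l) *: v) (l * r + (1 - l) * s).
Hypothesis Anonempty : forall u, C u -> exists r, A u r.
Hypothesis A0 : forall r, A 0 r -> r <= 0.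

(** Graphs of partial linear functionals lying above the hypograph [A]. Single-valuedness is a
    consequence of domination and is derived only for the maximal graph. The empty graph qualifies,
    so empty chains are harmless in Zorn's lemma. *)
Let adm (G : set (V * R)) :=
  [/\ forall a p q, G p -> G q -> G (a *: p.1 + q.1, a * p.2 + q.2),
      forall p, G p -> C p.1
    & forall v r s, G (v, s) -> A v r -> r <= s].

Let C0 u : C u -> C 0.
Proof. by move=> Cu; have := Clin (-1) Cu Cu; rewrite scaleN1r addNr. Qed.

Let CZ a u : C u -> C (a *: u).
Proof. by move=> Cu; have := Clin a Cu (C0 Cu); rewrite addr0. Qed.

Let adm_bigcup (F : set (set (V * R))) :
  F `<=` adm -> total_on F subset -> adm (\bigcup_(G in F) G).
Proof.
move=> Fadm Ftot; split.
- move=> a p q [G FG Gp] [H FH Hq].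
  have [GH|HG] := Ftot _ _ FG FH.
    by exists H => //; have [+ _ _] := Fadm _ FH; apply=> //; exact: GH.
  by exists G => //; have [+ _ _] := Fadm _ FG; apply=> //; exact: HG.
- by move=> p [G FG Gp]; have [_ + _] := Fadm _ FG; exact.
- by move=> v r s [G FG Gp]; have [_ _ /(_ v r s)] := Fadm _ FG; exact.
Qed.

(** The slope [rho] along [u] must exceed all quotients from points [v + t u] and stay below all
    quotients from points [v - t u]. By [key] these two families are ordered, and the supremum of
    the lower one serves. *)
Let adm_extension (G : set (V * R)) (u : V) : adm G -> G !=set0 -> C u ->
  exists rho, forall v s t r, G (v, s) -> A (v + t *: u) r -> r <= s + t * rho.
Proof.
move=> [Glin GC GA] [[v0 s0] G0] Cu.
have G00 : G (0, 0).
  by have := Glin (-1) _ _ G0 G0; rewrite /= scaleN1r addNr mulN1r addNr.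
have key v1 s1 t1 r1 v2 s2 t2 r2 : 0 < t1 -> 0 < t2 -> G (v1, s1) -> G (v2, s2) ->
    A (v1 + t1 *: u) r1 -> A (v2 - t2 *: u) r2 -> (r1 - s1) / t1 <= (s2 - r2) / t2.
  move=> t10 t20 G1 G2 A1 A2.
  have t0 : 0 < t1 + t2 by rewrite addr_gt0.
  (* This weight makes the [u] components cancel: [l t1 = (1 - l) t2]. *)
  pose l := t2 / (t1 + t2).
  have l1 : 1 - l = t1 / (t1 + t2) by rewrite /l; field; rewrite gt_eqF.
  have l01 : 0 <= l <= 1.
    rewrite /l divr_ge0 ?(ltW t0) ?(ltW t20)//=.
    by rewrite ler_pdivrMr// mul1r lerDr ltW.
  have CA1 : C (v1 + t1 *: u) by rewrite addrC; apply: Clin => //; exact: GC G1.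
  have CA2 : C (v2 - t2 *: u).
    by rewrite addrC -scaleNr; apply: Clin => //; exact: GC G2.
  have := Aconv CA1 CA2 A1 A2 l01.
  have -> : l *: (v1 + t1 *: u) + (1 - l) *: (v2 - t2 *: u) =
            l *: v1 + (1 - l) *: v2.
    rewrite !scalerDr scalerN !scalerA addrACA -[RHS]addr0; congr (_ + _).
    rewrite -scaleNr -scalerDl.
    suff -> : l * t1 + - ((1 - l) * t2) = 0 by rewrite scale0r.
    by rewrite l1 /l; ring.
  have Gl : G (l *: v1 + (1 - l) *: v2, l * s1 + (1 - l) * s2).
    have := Glin (1 - l) _ _ G2 G00; rewrite /= !addr0 => G2'.
    by have := Glin l _ _ G1 G2'.
  move=> /(GA _ _ _ Gl); rewrite l1 /l => le.
  rewrite ler_pdivrMr// mulrAC ler_pdivlMr//.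
  have : (t2 / (t1 + t2) * r1 + t1 / (t1 + t2) * r2) * (t1 + t2) <=
    (t2 / (t1 + t2) * s1 + t1 / (t1 + t2) * s2) * (t1 + t2) by rewrite ler_pM2r.
  have e a b : (t2 / (t1 + t2) * a + t1 / (t1 + t2) * b) * (t1 + t2) =
     t2 * a + t1 * b by field; rewrite gt_eqF.
  by rewrite !e; lra.
pose lo := [set x | exists v s t r,
  [/\ 0 < t, G (v, s), A (v + t *: u) r & x = (r - s) / t]].
have [r1 A1] := Anonempty Cu.
have [r2 A2] : exists r, A (- u) r.
  by apply: Anonempty; rewrite -scaleN1r; exact: CZ.
have lo0 : lo !=set0.
  by exists ((r1 - 0) / 1), 0, 0, 1, r1; split => //; rewrite add0r scale1r.
have loub : ubound lo ((0 - r2) / 1).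
  move=> _ [v [s [t [r [t0 Gv Ar ->]]]]].
  by apply: (key _ _ _ _ 0) => //; first exact: Gv; rewrite // add0r scale1r.
exists (sup lo) => v s t r Gv Ar.
case: (ltgtP t 0) => [t0|t0|t0]; last first.
- by move: Ar; rewrite t0 scale0r addr0 mul0r addr0; exact: GA.
- rewrite -lerBlDl mulrC -ler_pdivrMr//.
  by apply: ub_le_sup; [exists ((0 - r2) / 1)|exists v, s, t, r].
have : sup lo <= (s - r) / (- t).
  apply: ge_sup => // _ [v' [s' [t' [r' [t'0 Gv' Ar' ->]]]]].
  apply: key Gv' Gv Ar' _ => //; first by rewrite oppr_gt0.
  by rewrite scaleNr opprK.
by rewrite ler_pdivlMr ?oppr_gt0//; lra.
Qed.

Let adm_total : exists2 G, adm G & forall u, C u -> exists r, G (u, r).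
Proof.
have [G [Gadm Gmax]] := Zorn_bigcup adm_bigcup.
exists G => // u Cu.
have G0 : G !=set0.
  (* An empty maximal graph is excluded by the zero graph, which is admissible because of [A0]. *)
  apply/set0P/eqP => G0; apply: (Gmax [set (0, 0)]).
    by rewrite G0 properEneq; split => //; apply/eqP => /seteqP[_ /(_ (0,0))]; exact.
  split.
  - by move=> a p q /= -> -> /=; rewrite scaler0 !addr0 mulr0.
  - by move=> p -> /=; exact: C0 Cu.
  - by move=> v r s [-> ->]; exact: A0.
apply: contrapT => nGu.
have [rho rhoP] := adm_extension Gadm G0 Cu.
have [Glin GC GA] := Gadm.
pose G' := [set p : V * R | exists v s t, G (v, s) /\
             p = (v + t *: u, s + t * rho)].
apply: (Gmax G').
  split; last first.
    move=> G'G; apply: nGu; exists rho; apply: G'G.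
    have [[v s] Gv] := G0; exists 0, 0, 1; split.
      by have := Glin (-1) _ _ Gv Gv; rewrite /= scaleN1r addNr mulN1r addNr.
    by rewrite !add0r scale1r mul1r.
  by move=> [v s] Gv; exists v, s, 0; rewrite scale0r mul0r !addr0.
split.
- move=> a _ _ [v [s [t [Gv ->]]]] [v' [s' [t' [Gv' ->]]]].
  exists (a *: v + v'), (a * s + s'), (a * t + t'); split; first exact: Glin Gv Gv'.
  congr (_, _) => /=; last by ring.
  by rewrite scalerDr scalerDl addrACA scalerA.
- move=> _ [v [s [t [Gv ->]]]] /=; rewrite addrC; apply: Clin => //.
  exact: GC Gv.
- by move=> w r ws [v [s [t [Gv [-> ->]]]]]; exact: rhoP.
Qed.

Lemma hahn_banach_separation : exists L : V -> R,
  (forall a u v, C u -> C v -> L (a *: u + v) = a * L u + L v) /\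
  (forall u r, C u -> A u r -> r <= L u).
Proof.
have [G [Glin GC GA] Gtot] := adm_total.
pose L u := xget 0 [set r | G (u, r)].
have GL u : C u -> G (u, L u).
  by move=> /Gtot[r Gr]; apply: (@xgetPex _ 0 [set r | G (u, r)]); exists r.
(* Two values at [v] put every [(0, k (s - r))] into [G]. Domination then bounds a fixed number by
   all multiples of [s - r], so [s - r] vanishes. *)
have Guniq v r s : G (v, r) -> G (v, s) -> r = s.
  move=> Gr Gs; apply/eqP; rewrite -subr_eq0; apply/eqP.
  have G0 : G (0, s - r).
    by have := Glin (-1) _ _ Gr Gs; rewrite /= scaleN1r addNr mulN1r addrC.
  have [x Ax] := Anonempty (GC _ G0).
  have G00 : G (0, 0).
    by have := Glin (-1) _ _ G0 G0; rewrite /= scaleN1r addNr mulN1r addNr.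
  have xk k : x <= k * (s - r).
    apply: (GA _ _ _ _ Ax).
    by have := Glin k _ _ G0 G00; rewrite /= scaler0 !addr0.
  apply/eqP; rewrite -oppr_eq0 opprB; apply/negPn/negP => sr.
  by have := xk ((x - 1) / (s - r)); rewrite divfK//; lra.
exists L; split.
- move=> a u v Cu Cv; apply: (Guniq (a *: u + v)); first exact/GL/Clin.
  exact: Glin (GL _ Cu) (GL _ Cv).
- by move=> u r Cu; exact: GA (GL _ Cu).
Qed.

End hahn_banach.

(** * The Daniell-Stone representation theorem *)

Section daniell_stone.
Variables (R : realType) (X : pointedType) (Om : set X).
Variables (C : set (X -> R)) (L : (X -> R) -> R).
Hypothesis C1 : C (fun=> 1).
Hypothesis Clin : forall a f g, C f -> C g -> C (fun x => a * f x + g x).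
Hypothesis Cmax : forall f g, C f -> C g -> C (fun x => Num.max (f x) (g x)).
Hypothesis Llin : forall a f g, C f -> C g ->
  L (fun x => a * f x + g x) = a * L f + L g.
Hypothesis Lpos : forall f, C f -> (forall x, Om x -> 0 <= f x) -> 0 <= L f.
Hypothesis L1 : L (fun=> 1) = 1.
Hypothesis Lcont : forall h : nat -> X -> R, (forall k, C (h k)) ->
  (forall k x, Om x -> 0 <= h k.+1 x <= h k x) ->
  (forall x e, Om x -> 0 < e -> exists k, h k x < e) ->
  forall e, 0 < e -> exists k, L (h k) < e.

Let C0 : C (fun=> 0).
Proof. by have := Clin (-1) C1 C1; under eq_fun do rewrite mulN1r addNr. Qed.

Let L0 : L (fun=> 0) = 0.
Proof.
have := Llin (-1) C1 C1.
under eq_fun do rewrite mulN1r addNr.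
by rewrite mulN1r addNr.
Qed.

Let CZ a f : C f -> C (fun x => a * f x).
Proof. by move=> Cf; have := Clin a Cf C0; under eq_fun do rewrite addr0. Qed.

Let LZ a f : C f -> L (fun x => a * f x) = a * L f.
Proof.
by move=> Cf; have := Llin a Cf C0; under eq_fun do rewrite addr0; rewrite L0 addr0.
Qed.

Let CD f g : C f -> C g -> C (fun x => f x + g x).
Proof. by move=> Cf Cg; have := Clin 1 Cf Cg; under eq_fun do rewrite mul1r. Qed.

Let LD f g : C f -> C g -> L (fun x => f x + g x) = L f + L g.
Proof.
by move=> Cf Cg; have := Llin 1 Cf Cg; under eq_fun do rewrite mul1r; rewrite mul1r.
Qed.

Let CB f g : C f -> C g -> C (fun x => f x - g x).
Proof.
by move=> Cf Cg; have := Clin (-1) Cg Cf; under eq_fun do rewrite mulN1r addrC.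
Qed.

Let LB f g : C f -> C g -> L (fun x => f x - g x) = L f - L g.
Proof.
move=> Cf Cg; have := Llin (-1) Cg Cf.
by under eq_fun do rewrite mulN1r addrC; rewrite mulN1r addrC.
Qed.

Let Ccst a : C (fun=> a).
Proof. by have := CZ a C1; under eq_fun do rewrite mulr1. Qed.

Let Lcst a : L (fun=> a) = a.
Proof. by have := LZ a C1; under eq_fun do rewrite mulr1; rewrite L1 mulr1. Qed.

Let Cmin f g : C f -> C g -> C (fun x => Num.min (f x) (g x)).
Proof.
move=> Cf Cg; have -> : (fun x => Num.min (f x) (g x)) =
    (fun x => f x + g x - Num.max (f x) (g x)).
  by apply/funext => x; rewrite -(addr_max_min (f x)) addrAC subrr add0r.
by apply: CB; [exact: CD|exact: Cmax].
Qed.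

Let le_L f g : C f -> C g -> (forall x, Om x -> f x <= g x) -> L f <= L g.
Proof.
move=> Cf Cg fg; rewrite -subr_ge0 -LB//; apply: Lpos; first exact: CB.
by move=> x Ox; rewrite subr_ge0 fg.
Qed.

Let le_min2 (a b c d : R) : a <= c -> b <= d -> Num.min a b <= Num.min c d.
Proof. by move=> ac bd; rewrite le_min !ge_min ac bd orbT. Qed.

(** [mu] is Daniell's upper integral of the indicator of [A]. Increasing sequences instead of single
    functions give countable subadditivity. All comparisons are made on [Om] only, so [mu] does not
    see the complement of [Om]. *)
Let cov (A : set X) (r : R) := exists H : nat -> X -> R,
  [/\ forall k, C (H k), forall k x, Om x -> 0 <= H k x,
      forall k x, Om x -> H k x <= H k.+1 x,
      forall k, L (H k) <= r
    & forall x, Om x -> A x -> exists k, 1 <= H k x].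

Let H_mono (H : nat -> X -> R) x : (forall k, H k x <= H k.+1 x) ->
  forall j k, (j <= k)%N -> H j x <= H k x.
Proof. by move=> H1; apply/nondecreasing_seqP. Qed.

Let mu (A : set X) : \bar R := ereal_inf [set r%:E | r in cov A].

Let cov_ge0 A r : cov A r -> 0 <= r.
Proof. by move=> [H [CH H0 _ HL _]]; apply: le_trans (HL 0%N); exact/Lpos/H0. Qed.

Let mu_ge0 A : (0 <= mu A)%E.
Proof. by apply: le_ereal_inf_tmp => _ [r /cov_ge0 r0 <-]; rewrite lee_fin. Qed.

Let mu_le_cov A r : cov A r -> (mu A <= r%:E)%E.
Proof. by move=> Ar; apply: ereal_inf_lbound; exists r. Qed.

Let mu_le_L A f : C f -> (forall x, Om x -> 0 <= f x) ->
  (forall x, Om x -> A x -> 1 <= f x) -> (mu A <= (L f)%:E)%E.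
Proof.
move=> Cf f0 f1; apply: mu_le_cov; exists (fun=> f).
by split => // x Ox Ax; exists 0%N; exact: f1.
Qed.

Let mu0 : mu set0 = 0%E.
Proof.
apply/eqP; rewrite eq_le mu_ge0 andbT.
by have := @mu_le_L set0 _ C0; rewrite L0; apply.
Qed.

Let le_mu_on A B : (forall x, Om x -> A x -> B x) -> (mu A <= mu B)%E.
Proof.
move=> AB; apply: ereal_inf_le_tmp => _ [r [H [CH H0 Hi HL HB]] <-].
by exists r => //; exists H; split => // x Ox /(AB _ Ox); exact: HB.
Qed.

Let le_mu : {homo mu : A B / A `<=` B >-> (A <= B)%E}.
Proof. by move=> A B AB; apply: le_mu_on => x _; exact: AB. Qed.

Let mu_fin A : exists2 m, mu A = m%:E & 0 <= m.
Proof.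
have m1 : (mu A <= 1%:E)%E by have := @mu_le_L A _ C1; rewrite L1; apply.
move: (mu_ge0 A) m1; case: (mu A) => [r| |]//=; exists r => //.
Qed.

Let mu_cov A e : 0 < e -> exists2 r, cov A r & (r%:E <= mu A + e%:E)%E.
Proof.
move=> e0; have [m mE m0] := mu_fin A.
have : (mu A < mu A + e%:E)%E by rewrite mE -EFinD lte_fin ltrDl.
by move=> /ereal_inf_lt[_ [r Ar <-] /ltW]; exists r.
Qed.

(** Choose a cover [H i] of [F i] with error [e / 2^(i+1)]. The diagonal sums of [H i k] over
    [i <= k] increase with [k] and cover the union: a point reached by [H i] at stage [k] is reached
    at stage [max i k]. *)
Let mu_sigma_subadditive : sigma_subadditive mu.
Proof.
move=> F; have [->|fin] := eqVneq (\sum_(i <oo) mu (F i))%E +oo%E.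
  by rewrite leey.
apply/lee_addgt0Pr => e e0.
have r0 : (0 <= \sum_(i <oo) mu (F i))%E by apply: nneseries_ge0 => *; exact: mu_ge0.
have [s sE] : exists s, (\sum_(i <oo) mu (F i))%E = s%:E.
  by move: fin r0; case: (\sum_(i <oo) mu (F i))%E => [s| |]//; exists s.
have e2 i : 0 < e / (2 ^ i.+1)%:R by rewrite divr_gt0// ltr0n expn_gt0.
have /(_ _)/cid2-/all_sig2[q qcov qle] i := mu_cov (F i) (e2 i).
have /(_ _)/cid-/all_sig[H HP] i := qcov i.
rewrite sE -EFinD; apply: mu_le_cov.
pose G k x := \sum_(i < k.+1) H i k x.
have CG' m k : C (fun x => \sum_(i < m) H i k x).
  elim: m => [|m IH]; first by under eq_fun do rewrite big_ord0.
  under eq_fun do rewrite big_ord_recr/=.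
  by apply: CD => //; case: (HP m).
have LG m k : L (fun x => \sum_(i < m) H i k x) = \sum_(i < m) L (H i k).
  elim: m => [|m IH]; first by under eq_fun do rewrite big_ord0; rewrite big_ord0.
  under eq_fun do rewrite big_ord_recr/=.
  by rewrite LD ?IH ?big_ord_recr//; [exact: CG'|case: (HP m)].
have G0 i k x : Om x -> 0 <= H i k x by case: (HP i) => _ + _ _ _; exact.
exists G; split => [k|k x Ox|k x Ox|k|x Ox [i _ Fix]].
- exact: CG'.
- by apply: sumr_ge0 => i _; exact: G0.
- rewrite /G [leRHS]big_ord_recr/= -[leLHS]addr0 lerD ?G0//.
  by apply: ler_sum => i _; case: (HP i) => _ _ + _ _; exact.
- rewrite -lee_fin /G LG -sumEFin.
  apply: (@le_trans _ _ (\sum_(i < k.+1) (mu (F i) + (e / (2 ^ i.+1)%:R)%:E))%E).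
    apply: lee_sum => i _; apply: le_trans (qle i).
    by rewrite lee_fin; case: (HP i).
  rewrite EFinD -sE.
  apply: le_trans (epsilon_trick xpredT _ (ltW e0)); last by move=> n; exact: mu_ge0.
  rewrite -(big_mkord xpredT (fun i => (mu (F i) + (e / (2 ^ i.+1)%:R)%:E)%E)).
  apply: nneseries_lim_ge => n _ _; rewrite adde_ge0 ?mu_ge0// lee_fin.
  exact/ltW/e2.
- have [_ _ Hi _ /(_ x Ox Fix)[k Hk]] := HP i.
  exists (maxn i k); apply: (le_trans Hk).
  apply: le_trans (H_mono (fun k => Hi k x Ox) (leq_maxr i k)) _.
  rewrite /G (bigD1 (Ordinal (leq_maxl i k : (i < (maxn i k).+1)%N)))//= lerDl.
  by apply: sumr_ge0 => j _; exact: G0.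
Qed.

Let muO : outer_measure R X := HB.pack mu
  (isOuterMeasure.Build R X mu mu0 mu_ge0 le_mu mu_sigma_subadditive).

(* The sequence [min (h_k, min (1, k g))] covers the part of [A] in [0 < g], and
   for each m what remains, [(h_k - min (1, m g))^+], covers the rest of [A]. *)
Let caratheodory_pos g : C g -> (forall x, Om x -> 0 <= g x) ->
  caratheodory_measurable mu [set x | 0 < g x].
Proof.
move=> Cg g0; apply: (@le_caratheodory_measurable _ _ muO) => A.
apply: le_ereal_inf_tmp => _ [r [H [CH H0 Hi HL HA]] <-].
pose gk (k : nat) x := Num.min 1 (k%:R * g x).
have Cgk k : C (gk k) by apply: Cmin => //; exact: CZ.
pose M k x := Num.min (H k x) (gk k x).
have CM k : C (M k) by exact: Cmin.
have gk_mono j k x : (j <= k)%N -> Om x -> gk j x <= gk k x.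
  by move=> jk Ox; apply: le_min2 => //; rewrite ler_wpM2r ?g0// ler_nat.
have M_mono j k x : (j <= k)%N -> Om x -> M j x <= M k x.
  move=> jk Ox; apply: le_min2; last exact: gk_mono.
  exact: (H_mono (fun k => Hi k x Ox)).
have gk0 k x : Om x -> 0 <= gk k x.
  by move=> Ox; rewrite le_min ler01 mulr_ge0// g0.
have M0 k x : Om x -> 0 <= M k x by move=> Ox; rewrite le_min H0// gk0.
have LM_le k : L (M k) <= r.
  apply: le_trans (HL k); apply: le_L => // x Ox.
  by rewrite /M ge_min lexx.
pose a := sup (range (fun k => L (M k))).
have supM : has_sup (range (fun k => L (M k))).
  by split; [exists (L (M 0%N)), 0%N|exists r => _ [k _ <-]].
have aub k : L (M k) <= a by apply: ub_le_sup; [case: supM|exists k].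
have mu1 : (mu (A `&` [set x | (0 < g x)%R]) <= a%:E)%E.
  apply: mu_le_cov; exists M; split => // [k x Ox|x Ox [Ax /= gx]].
    exact: M_mono.
  have [k Hk] := HA x Ox Ax.
  pose n := Num.truncn (g x)^-1.
  exists (maxn k n.+1); rewrite /M /gk !le_min lexx/=.
  rewrite (le_trans Hk) ?(H_mono (fun k => Hi k x Ox)) ?leq_maxl//=.
  rewrite -ler_pdivrMr// mul1r (@le_trans _ _ n.+1%:R)//.
    exact/ltW/truncnS_gt.
  by rewrite ler_nat leq_maxr.
have mu2 m : (mu (A `&` ~` [set x | (0 < g x)%R]) <= (r - L (M m))%:E)%E.
  apply: mu_le_cov.
  (* The shift by [m] makes the subtracted minimum at least [M m], so that [L (D k) <= r - L (M m)]
     for every [k]. *)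
  pose D k x := H (k + m)%N x - Num.min (H (k + m)%N x) (gk m x).
  have DE k x : D k x = Num.max (H (k + m)%N x - gk m x) 0.
    by rewrite /D; case: (leP (H _ x) (gk m x)) => h; [rewrite subrr max_r// subr_le0|
       rewrite max_l// subr_ge0 ltW].
  exists D; split => [k|k x Ox|k x Ox|k|x Ox [Ax /= gx]].
  - by apply: CB => //; exact: Cmin.
  - by rewrite DE le_max lexx orbT.
  - by rewrite !DE ge_max !le_max lexx orbT andbT lerB// Hi.
  - rewrite /D LB//; last exact: Cmin.
    rewrite lerB ?HL//; apply: le_L => //; first exact: Cmin.
    move=> x Ox; apply: le_min2 => //.
    by apply: (H_mono (fun k => Hi k x Ox)); rewrite leq_addl.
  - have [k Hk] := HA x Ox Ax; exists k; rewrite DE le_max; apply/orP; left.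
    have -> : gk m x = 0.
      have gx0 : g x = 0 by apply/eqP; rewrite eq_le g0// andbT leNgt; exact/negP.
      by rewrite /gk gx0 mulr0 min_r.
    by rewrite subr0 (le_trans Hk)// (H_mono (fun k => Hi k x Ox)) ?leq_addr.
have [b bE b0] := mu_fin (A `&` ~` [set x | 0 < g x]).
have ab : a <= r - b.
  apply: ge_sup => [|_ [m _ <-]]; first by case: supM.
  by have := mu2 m; rewrite bE lee_fin; lra.
rewrite [X in (_ + X <= _)%E]bE (le_trans (leeD2r _ mu1))// -EFinD lee_fin; lra.
Qed.

(** For any cover [H] of [A], the positive parts of [f - H k] decrease to zero pointwise: on [A]
    because [H k] reaches [1], off [A] because [f <= 0]. Continuity of [L] along such sequences
    gives [L f <= r]. *)
Let L_le_mu A f : C f -> (forall x, Om x -> f x <= 1) ->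
  (forall x, Om x -> ~ A x -> f x <= 0) -> ((L f)%:E <= mu A)%E.
Proof.
move=> Cf f1 f0; apply: le_ereal_inf_tmp => _ [r [H [CH H0 Hi HL HA]] <-].
rewrite lee_fin; apply/ler_addgt0Pr => e e0.
have CfH k : C (fun x => f x - H k x) by exact: CB.
have [|||k Lk] := @Lcont (fun k x => Num.max (f x - H k x) 0) _ _ _ _ e0.
- by move=> k; exact: Cmax.
- move=> k x Ox; rewrite ge_max !le_max lexx !orbT /= andbT.
  by rewrite lerB// Hi.
- move=> x d Ox d0; have [Ax|nAx] := pselect (A x).
    have [k Hk] := HA x Ox Ax; exists k.
    by rewrite max_r// subr_le0 (le_trans (f1 _ Ox)).
  by exists 0%N; rewrite max_r// subr_le0 (le_trans (f0 _ Ox nAx))// H0.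
- have : L (fun x => f x - H k x) <= L (fun x => Num.max (f x - H k x) 0).
    by apply: le_L => //; [exact: Cmax|move=> x _; rewrite le_max lexx].
  by rewrite LB//; have := HL k; lra.
Qed.

Let mu1 : mu setT = 1%E.
Proof.
apply/eqP; rewrite eq_le; apply/andP; split.
  by have := @mu_le_L setT _ C1; rewrite L1; apply.
by have := @L_le_mu setT _ C1; rewrite L1; apply => // x _ [].
Qed.

(** * Restriction of the outer measure to the generated sigma-algebra *)

Variable G : set (set X).
Hypothesis GC : forall U, G U -> exists g, [/\ C g, forall x, Om x -> 0 <= g x
  & forall x, Om x -> U x <-> 0 < g x].

Notation XG := (g_sigma_algebraType G).

(** Caratheodory sets form a sigma-algebra, so generators suffice. On [Om] each generator agrees
    with a positivity set, and [mu] compares sets on [Om] only. *)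
Let sigmaG_caratheodory (A : set XG) :
  measurable A -> caratheodory_measurable mu A.
Proof.
suff : <<s G >> `<=` caratheodory_measurable mu by exact.
apply: smallest_sub.
  split; first exact: (caratheodory_measurable_set0 muO).
  - by move=> B mB; rewrite setTD; exact: (@caratheodory_measurable_setC _ _ muO B mB).
  - by move=> F mF; exact: (@caratheodory_measurable_bigcup _ _ muO F mF).
move=> U /GC[g [Cg g0 Ug]]; apply: (@le_caratheodory_measurable _ _ muO) => B.
rewrite [leRHS](caratheodory_pos Cg g0 B).
apply: leeD; apply: le_mu_on => x Ox [Bx Ux]; split => //.
  exact/(Ug x Ox).
by move=> gx; apply: Ux; exact/(Ug x Ox).
Qed.

Let mu_sigma_additive : semi_sigma_additive (mu : set XG -> \bar R).
Proof.
move=> F mF tF mUF; apply: (@caratheodory_measure_sigma_additive _ _ muO) => //.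
  by move=> i; exact: sigmaG_caratheodory (mF i).
exact: sigmaG_caratheodory mUF.
Qed.

Let muM : {measure set XG -> \bar R} := HB.pack (mu : set XG -> \bar R)
  (isMeasure.Build _ _ _ (mu : set XG -> \bar R) mu0 mu_ge0 mu_sigma_additive).

Let muP : probability XG R := HB.pack (Measure.sort muM) (Measure.class muM)
  (Measure_isProbability.Build _ _ _ (Measure.sort muM) mu1).

Hypothesis mOm : measurable (Om : set XG).
Hypothesis mC : forall f, C f -> measurable_fun (Om : set XG) (f : XG -> R).

(** * Identification of [L] with the integral *)

Let I (f : X -> R) := (\int[muP]_(x in (Om : set XG)) (f x)%:E)%E.

Let mCE f : C f -> measurable_fun (Om : set XG) (fun x : XG => (f x)%:E).
Proof. by move=> Cf; apply/measurable_EFinP; exact: mC. Qed.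

Let ID f g : C f -> C g -> (forall x, Om x -> 0 <= f x) ->
  (forall x, Om x -> 0 <= g x) -> I (fun x => f x + g x) = (I f + I g)%E.
Proof.
by move=> Cf Cg f0 g0; rewrite /I -ge0_integralD//=; exact: mCE.
Qed.

Let le_I f g : C f -> C g -> (forall x, Om x -> 0 <= f x) ->
  (forall x, Om x -> f x <= g x) -> (I f <= I g)%E.
Proof.
by move=> Cf Cg f0 fg; apply: ge0_le_integral => //=; exact: mCE.
Qed.

Let I_ge0 f : (forall x, Om x -> 0 <= f x) -> (0 <= I f)%E.
Proof. by move=> f0; apply: integral_ge0 => x Ox; rewrite lee_fin f0. Qed.

Let muOm : muP Om = 1%E.
Proof.
apply/eqP; rewrite eq_le probability_le1//=.
by rewrite -mu1; apply: le_mu_on.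
Qed.

Let Icst r : I (fun=> r) = r%:E.
Proof. by rewrite /I (integral_cst muP mOm) [X in (_ * X)%E]muOm mule1. Qed.

Let trunc (f : X -> R) (n : nat) x := Num.min (f x) n%:R.

Let Ctrunc f n : C f -> C (trunc f n).
Proof. by move=> Cf; exact: Cmin. Qed.

Let trunc_ge0 f n : (forall x, Om x -> 0 <= f x) ->
  forall x, Om x -> 0 <= trunc f n x.
Proof. by move=> f0 x Ox; rewrite /trunc le_min f0//=. Qed.

(* Layer by layer: [L (f /\ (n+2) - f /\ (n+1)) <= mu (f > n+1)
   <= I (f /\ (n+1) - f /\ n)]. *)
Let L_trunc_le f n : C f -> (forall x, Om x -> 0 <= f x) ->
  ((L (trunc f n.+1))%:E <= 1 + I (trunc f n))%E.
Proof.
move=> Cf f0; elim: n => [|n IH].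
  apply: (@le_trans _ _ 1%E); last by rewrite leeDl// I_ge0//; exact: trunc_ge0.
  rewrite -[X in (_ <= X%:E)%E]L1 lee_fin; apply: le_L => //; first exact: Ctrunc.
  by move=> x Ox; rewrite /trunc ge_min lexx orbT.
pose g x := trunc f n.+2 x - trunc f n.+1 x.
pose h x := trunc f n.+1 x - trunc f n x.
have Cg : C g by apply: CB; exact: Ctrunc.
have Ch : C h by apply: CB; exact: Ctrunc.
have h0 x : Om x -> 0 <= h x.
  by move=> Ox; rewrite subr_ge0 /trunc le_min2// ler_nat.
have -> : L (trunc f n.+2) = L (trunc f n.+1) + L g.
  by rewrite LB ?subrKC//; exact: Ctrunc.
have -> : I (trunc f n.+1) = (I (trunc f n) + I h)%E.
  rewrite -ID//; [|exact: Ctrunc|exact: trunc_ge0].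
  by congr I; apply/funext => x; rewrite /h subrKC.
rewrite EFinD addeA; apply: leeD => //.
pose A := Om `&` f @^-1` `]n.+1%:R, +oo[%classic.
have mA : measurable (A : set XG) by apply: mC.
apply: (@le_trans _ _ (mu A)).
  apply: L_le_mu => // x Ox.
    rewrite /g /trunc; case: (leP (f x) n.+2%:R) => f1;
    case: (leP (f x) n.+1%:R) => f2; rewrite -!natr1 in f1 f2 *; lra.
  move=> nA; have {}nA : f x <= n.+1%:R.
    by rewrite leNgt; apply/negP => fx; apply: nA; split; rewrite //= in_itv/= fx.
  by rewrite /g /trunc !min_l ?subrr// (le_trans nA)// ler_nat.
have -> : mu A = (\int[muP]_(x in Om) (\1_A x)%:E)%E.
  by rewrite integral_indic// setIAC setIid.
apply: ge0_le_integral => //=; last first.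
- move=> x Ox; rewrite lee_fin indicE; case: (boolP (x \in A)) => [|_]; last exact: h0.
  rewrite inE => -[_]; rewrite /= in_itv/= andbT => fx.
  rewrite /h /trunc !min_r ?(ltW fx)//; first by rewrite -natr1; lra.
  by rewrite (le_trans _ (ltW fx))// ler_nat.
- exact: mCE.
- apply/measurable_EFinP; exact/measurable_funTS/measurable_indic.
Qed.

(** Letting the truncation level grow yields [L g <= 1 + I g]. The additive error is removed by
    homogeneity: apply this to [f / e], multiply by [e], and let [e] tend to zero. *)
Let L_le_I f : C f -> (forall x, Om x -> 0 <= f x) -> ((L f)%:E <= I f)%E.
Proof.
have L_le_1I g : C g -> (forall x, Om x -> 0 <= g x) -> ((L g)%:E <= 1 + I g)%E.
  move=> Cg g0; apply/lee_addgt0Pr => e e0.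
  have [|k x Ox|x d Ox d0|k] := @Lcont (fun k x => g x - trunc g k x) _ _ _ _ e0.
  - by move=> k; apply: CB => //; exact: Ctrunc.
  - rewrite subr_ge0 lerB//; last by rewrite /trunc le_min2// ler_nat.
    by rewrite /trunc ge_min lexx.
  - exists (Num.truncn (g x)).+1; rewrite /trunc min_l ?subrr//.
    exact/ltW/truncnS_gt.
  - rewrite LB//; last exact: Ctrunc.
    move=> Lk; apply: (@le_trans _ _ ((L (trunc g k.+1))%:E + e%:E)%E).
      rewrite -EFinD lee_fin.
      have : L (trunc g k) <= L (trunc g k.+1).
        apply: le_L; [exact: Ctrunc|exact: Ctrunc|move=> x Ox].
        by rewrite /trunc le_min2// ler_nat.
      by lra.
    rewrite leeD2r// (le_trans (L_trunc_le k Cg g0))// leeD2l//.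
    apply: le_I => //; [exact: Ctrunc|exact: trunc_ge0|move=> x Ox].
    by rewrite /trunc ge_min lexx.
move=> Cf f0; have [->|Ify] := eqVneq (I f) +oo%E; first by rewrite leey.
have [y yE] : exists y, I f = y%:E.
  by move: Ify (I_ge0 f0); case: (I f) => [y| |]// _ _; exists y.
rewrite yE lee_fin; apply/ler_addgt0Pr => e e0.
have Cef := CZ e^-1 Cf.
have ef0 x : Om x -> 0 <= e^-1 * f x.
  by move=> Ox; rewrite mulr_ge0 ?f0// invr_ge0 ltW.
have IZ : I (fun x => e^-1 * f x) = (e^-1 * y)%:E.
  rewrite /I; under eq_integral do rewrite EFinM.
  rewrite ge0_integralZl_EFin//; last 2 first.
  - exact: mCE.
  - by rewrite invr_ge0 ltW.
  - by rewrite EFinM -yE.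
have := L_le_1I _ Cef ef0; rewrite LZ// IZ -EFinD lee_fin.
by rewrite -(ler_pM2l e0) mulrDr !mulrA divff ?gt_eqF// mul1r mulr1 mul1r addrC.
Qed.

(** The reverse inequality is the previous one for [n - min (f, n)], because [L] and [I] agree on
    constants. Monotone convergence then removes the truncation. *)
Let I_eq_L f : C f -> (forall x, Om x -> 0 <= f x) -> I f = (L f)%:E.
Proof.
move=> Cf f0; apply/eqP; rewrite eq_le L_le_I// andbT.
have I_trunc n : (I (trunc f n) <= (L f)%:E)%E.
  pose g x := n%:R - trunc f n x.
  have Cg : C g by apply: CB => //; exact: Ctrunc.
  have g0 x : Om x -> 0 <= g x by move=> Ox; rewrite subr_ge0 /trunc ge_min lexx orbT.
  have : (I g + I (trunc f n) = n%:R%:E)%E.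
    rewrite -ID//; [|exact: Ctrunc|exact: trunc_ge0].
    by rewrite -Icst; congr I; apply/funext => x; rewrite /g subrK.
  have := L_le_I Cg g0; rewrite LB//; last exact: Ctrunc.
  have := I_ge0 g0; have := I_ge0 (trunc_ge0 n f0).
  have : L (trunc f n) <= L f.
    by apply: le_L => //; [exact: Ctrunc|move=> x Ox; rewrite /trunc ge_min lexx].
  rewrite Lcst; case: (I g) => [a| |]//; case: (I (trunc f n)) => [b| |]// Lf _ _.
  by rewrite -EFinD !lee_fin => + -[]; lra.
have cvg_I : (I (trunc f n) @[n --> \oo] --> I f)%E.
  have -> : I f = (\int[muP]_(x in (Om : set XG))
      limn (fun n => (trunc f n x)%:E))%E.
    apply: eq_integral => x _; apply/esym/cvg_lim => //.
    apply: cvg_near_cst; near=> n; congr EFin; rewrite /trunc min_l//.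
    rewrite (le_trans (ltW (truncnS_gt (f x))))// ler_nat.
    by near: n; exact: nbhs_infty_ge.
  apply: cvg_monotone_convergence => //.
  - by move=> n; apply: mCE; exact: Ctrunc.
  - by move=> n x Ox; rewrite lee_fin; exact: trunc_ge0.
  - by move=> x Ox m n mn; rewrite lee_fin /trunc le_min2// ler_nat.
rewrite -(cvg_lim _ cvg_I)//; apply: lime_le; first by apply/cvg_ex; eexists; exact: cvg_I.
exact: nearW.
Unshelve. all: by end_near. Qed.

Lemma daniell_stone : exists Q : probability XG R,
  [/\ Q Om = 1%E,
      forall f, C f -> Q.-integrable (Om : set XG) (fun x : XG => (f x)%:E)
    & forall f, C f -> (\int[Q]_(x in (Om : set XG)) (f x)%:E = (L f)%:E)%E].
Proof.
have Cabs f : C f -> C (fun x => `|f x|).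
  move=> Cf; have := Cmax Cf (CZ (-1) Cf).
  suff -> : (fun x => Num.max (f x) (-1 * f x)) = (fun x => `|f x|) by [].
  by apply/funext => x; rewrite mulN1r maxrN.
have intC f : C f -> muP.-integrable (Om : set XG) (fun x : XG => (f x)%:E).
  move=> Cf; apply/integrableP; split; first exact: mCE.
  have -> : (\int[muP]_(x in (Om : set XG)) `|(f x)%:E| = I (fun x => `|f x|%R))%E by [].
  by rewrite I_eq_L ?ltry//; exact: Cabs.
exists muP; split => // f Cf.
have Cg := CD Cf (Cabs _ Cf).
(* A signed [f] is the difference of [f + |f|] and [|f|], both nonnegative and in [C]. *)
have -> : (\int[muP]_(x in (Om : set XG)) (f x)%:E =
    \int[muP]_(x in (Om : set XG)) ((f x + `|f x|)%:E - (`|f x|)%:E))%E.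
  by apply: eq_integral => x _; rewrite -EFinB addrK.
rewrite integralB//=; [|exact: (intC _ Cg)|exact: (intC _ (Cabs _ Cf))].
rewrite [X in (X - _)%E](I_eq_L Cg); last first.
  by move=> x _; rewrite -lerBlDl sub0r ler_normr lexx orbT.
rewrite [X in (_ - X)%E](I_eq_L (Cabs _ Cf)); last by [].
by rewrite LD ?EFinD ?addeK//; exact: Cabs.
Qed.

End daniell_stone.

(** * Semicontinuity, Dini's theorem and inf-convolution *)

Section topology_lemmas.
Variables (R : realType) (T : ptopologicalType).
Notation Borel := (g_sigma_algebraType (@open T)).

(** A strict superlevel set in [A] is the trace on [A] of an open set, namely the interior of the
    set where membership in [A] implies [a < c]. *)
Lemma measurable_fun_lsc (A : set T) (c : T -> \bar R) :
  measurable (A : set Borel) ->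
  (forall x, A x -> forall a : R, (a%:E < c x)%E ->
     nbhs x [set y | A y -> (a%:E < c y)%E]) ->
  measurable_fun (A : set Borel) (c : Borel -> \bar R).
Proof.
move=> mA lsc; apply: (measurability _ (ErealGenOInfty.measurableE R)).
move=> _ [_ [a ->] <-].
have -> : A `&` c @^-1` `]a%:E, +oo[%classic =
    A `&` [set y | A y -> (a%:E < c y)%E]°.
  apply/seteqP; split=> x [Ax]; rewrite /= ?in_itv/= ?andbT => acx.
    by split => //; exact: lsc.
  split => //=; rewrite ?in_itv/= ?andbT.
  by have := nbhs_singleton acx; exact.
by apply: measurableI => //; apply: sub_sigma_algebra; exact: open_interior.
Qed.

Lemma within_continuous_nbhs (A : set T) (f : T -> R) x (B : set R) :
  {within A, continuous f} -> A x -> nbhs (f x) B -> nbhs x [set y | A y -> B (f y)].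
Proof. by move=> /subspace_continuousP cf Ax fB; exact: (cf x Ax _ fB). Qed.

Lemma measurable_fun_within (A : set T) (f : T -> R) :
  measurable (A : set Borel) -> {within A, continuous f} ->
  measurable_fun (A : set Borel) (f : Borel -> R).
Proof.
move=> mA cf; apply/measurable_EFinP; apply: measurable_fun_lsc => // x Ax a.
rewrite lte_fin => afx.
have := within_continuous_nbhs cf Ax (lt_nbhsr afx).
by apply: filterS => y /=; rewrite lte_fin.
Qed.

(** If all sets where [e <= h k] met [K], these decreasing sets would generate a proper filter with
    a cluster point in [K]. There some [h k] is below [e], and remains so nearby on [A]. *)
Lemma dini (A K : set T) (h : nat -> T -> R) (e : R) : compact K -> K `<=` A ->
  (forall k, {within A, continuous (h k)}) ->
  (forall k x, A x -> h k.+1 x <= h k x) ->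
  (forall x, A x -> exists k, h k x < e) ->
  exists k, forall x, K x -> h k x < e.
Proof.
move=> cK KA ch hdecr hlt; apply: contrapT => nex.
pose B k := [set x | K x /\ e <= h k x].
have B0 k : B k !=set0.
  apply: contrapT => Bk0; apply: nex; exists k => x Kx; rewrite ltNge.
  by apply/negP => eh; apply: Bk0; exists x.
have hmono x j k : A x -> (j <= k)%N -> h k x <= h j x.
  move=> Ax; have /(@nonincreasing_seqP _ _ (h ^~ x)) := fun i => hdecr i x Ax.
  exact.
have Bdecr j k : (j <= k)%N -> B k `<=` B j.
  by move=> jk x [Kx ehk]; split => //; rewrite (le_trans ehk)// hmono//; exact: KA.
pose F := filter_from [set: nat] B.
have FF : ProperFilter F.
  apply: filter_from_proper; last by move=> k _; exact: B0.
  apply: filter_from_filter; first by exists 0%N.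
  move=> i j _ _; exists (maxn i j) => // x Bx.
  by split; apply: Bdecr Bx; rewrite ?leq_maxl ?leq_maxr.
have FK : F K by exists 0%N => // x [].
have [p [Kp clp]] := cK F FF FK.
have [k hk] := hlt _ (KA _ Kp).
have nb := within_continuous_nbhs (ch k) (KA _ Kp) (lt_nbhsl hk).
have FB : F (B k) by exists k.
have [x [[Kx ehk] /(_ (KA _ Kx)) /= hke]] := clp (B k) _ FB nb.
by rewrite ltNge ehk in hke.
Qed.

End topology_lemmas.

Section inf_convolution.
Variables (R : realType) (V : normedModType R) (A : set V) (b : V -> R) (n : R).
Hypothesis n0 : 0 < n.
Hypothesis b0 : forall y, A y -> 0 <= b y.

(** The Pasch-Hausdorff envelope: on [A], the largest [n]-Lipschitz minorant of [b]. It serves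
    twice, for indicators of open sets and for approximating [c] from below. *)
Definition inf_convolution (x : V) : R := inf [set b y + n * `|x - y| | y in A].

Let lb0 x : lbound [set b y + n * `|x - y| | y in A] 0.
Proof. by move=> _ [y Ay <-]; rewrite addr_ge0 ?b0// mulr_ge0// ltW. Qed.

Let le_infc x y : A y -> inf_convolution x <= b y + n * `|x - y|.
Proof. by move=> Ay; apply: ge_inf; [exists 0; exact: lb0|exists y]. Qed.

Let ge_infc x a : A !=set0 -> (forall y, A y -> a <= b y + n * `|x - y|) ->
  a <= inf_convolution x.
Proof.
move=> [y0 Ay0] h; apply: lb_le_inf; first by exists (b y0 + n * `|x - y0|), y0.
by move=> _ [y Ay <-]; exact: h.
Qed.

Lemma inf_convolution_ge0 x : A x -> 0 <= inf_convolution x.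
Proof.
move=> Ax; apply: ge_infc; first by exists x.
by move=> y Ay; apply: lb0; exists y.
Qed.

Lemma inf_convolution_le x : A x -> inf_convolution x <= b x.
Proof. by move=> Ax; have := le_infc x Ax; rewrite subrr normr0 mulr0 addr0. Qed.

Lemma inf_convolution_continuous : {within A, continuous inf_convolution}.
Proof.
have lip x z : A !=set0 -> inf_convolution x - inf_convolution z <= n * `|x - z|.
  move=> A0; rewrite lerBlDr -lerBlDl; apply: ge_infc => // y Ay.
  rewrite lerBlDl (le_trans (le_infc x Ay))// addrCA lerD2l -mulrDr.
  by rewrite ler_pM2l// ler_distD.
apply/subspace_continuousP => x Ax.
apply: (@cvg_within_filter _ _ _ (nbhs x)).
apply/cvgrPdist_lt => e e0; near=> z.
have A0 : A !=set0 by exists x.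
have xz : n * `|x - z| < e.
  rewrite mulrC -ltr_pdivlMr//; near: z.
  by apply: cvgr_dist_lt => //; rewrite divr_gt0.
apply: le_lt_trans xz; rewrite ler_norml lip// andbT lerNl opprB distrC.
exact: lip.
Unshelve. all: by end_near. Qed.

(** Points within [r] of [x] contribute at least [a] through [b]; the others contribute at least
    [n r] through the distance penalty. *)
Lemma inf_convolution_gt x a r : A x -> 0 < r ->
  (forall y, A y -> `|x - y| < r -> a <= b y) ->
  Num.min a (n * r) <= inf_convolution x.
Proof.
move=> Ax r0 ab; apply: ge_infc; first by exists x.
move=> y Ay; rewrite ge_min; have [xy|xy] := ltP `|x - y| r.
  by rewrite (le_trans (ab _ Ay xy))// lerDl mulr_ge0// ltW.
by apply/orP; right; rewrite -[leLHS]add0r lerD ?b0// ler_pM2l.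
Qed.

End inf_convolution.

Lemma le_inf_convolution (R : realType) (V : normedModType R) (A : set V)
    (b b' : V -> R) (n n' : R) x : A x -> 0 < n ->
  (forall y, A y -> 0 <= b y) -> (forall y, A y -> b y <= b' y) -> n <= n' ->
  inf_convolution A b n x <= inf_convolution A b' n' x.
Proof.
move=> Ax n0 b0 bb' nn'; apply: lb_le_inf; first by eexists; exists x.
move=> _ [y Ay <-]; apply: (@le_trans _ _ (b y + n * `|x - y|)).
  apply: ge_inf; last by exists y.
  by exists 0 => _ [z Az <-]; rewrite addr_ge0 ?b0// mulr_ge0// ltW.
by rewrite lerD ?bb'// ler_wpM2r.
Qed.

(** Tychonoff's theorem for row vectors is transported along the continuous map that flattens a row
    of rows into a matrix. *)
Lemma compact_rows (R : realType) (m d : nat) (A : 'I_m -> set 'rV[R]_d) :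
  (forall t, compact (A t)) ->
  compact [set x : 'M[R]_(m, d) | forall t, A t (row t x)].
Proof.
move=> cA.
pose F (v : 'rV['rV[R]_d]_m) : 'M[R]_(m, d) := \matrix_(t, j) v ord0 t ord0 j.
have rowF v t : row t (F v) = v ord0 t by apply/rowP => j; rewrite !mxE.
have -> : [set x : 'M[R]_(m, d) | forall t, A t (row t x)] =
    F @` [set v : 'rV['rV[R]_d]_m | forall t, A t (v ord0 t)].
  apply/seteqP; split => [x Ax|_ [v Av <-] t]; last by rewrite rowF; exact: Av.
  exists (\row_t row t x); first by move=> t; rewrite mxE; exact: Ax.
  by apply/matrixP => i j; rewrite !mxE.
apply: continuous_compact; last exact: rV_compact.
apply: continuous_subspaceT => v B /nbhs_ballP[e /= e0 eB].
apply/nbhs_ballP; exists e => //= u [_ vu]; apply: eB; split => // t j.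
by rewrite !mxE; have [_] := vu ord0 t; exact.
Qed.

(** * Continuous functions of linear growth on the path space *)

Lemma row_continuous (R : realType) (m d : nat) (t : 'I_m) :
  continuous (row t : 'M[R]_(m, d) -> 'rV[R]_d).
Proof.
move=> x B /nbhs_ballP[e /= e0 eB]; apply/nbhs_ballP; exists e => //= y [_ xy].
by apply: eB; split => // i j; rewrite !mxE.
Qed.

Section within.
Variables (R : realType) (T : topologicalType) (A : set T).
Implicit Types f g : T -> R.

Lemma within_continuousD f g : {within A, continuous f} ->
  {within A, continuous g} -> {within A, continuous (fun x => f x + g x)}.
Proof. by move=> cf cg x; apply: cvgD; [exact: cf|exact: cg]. Qed.

Lemma within_continuousM f g : {within A, continuous f} ->
  {within A, continuous g} -> {within A, continuous (fun x => f x * g x)}.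
Proof. by move=> cf cg x; apply: cvgM; [exact: cf|exact: cg]. Qed.

Lemma within_continuous_max f g : {within A, continuous f} ->
  {within A, continuous g} -> {within A, continuous (fun x => Num.max (f x) (g x))}.
Proof. by move=> cf cg x; apply: continuous_max; [exact: cf|exact: cg]. Qed.

Lemma within_continuous_cst (a : R) : {within A, continuous (fun=> a)}.
Proof. by move=> x; exact: cvg_cst. Qed.

Lemma within_continuous_sum (I : finType) (f : I -> T -> R) :
  (forall i, {within A, continuous (f i)}) ->
  {within A, continuous (fun x => \sum_i f i x)}.
Proof.
move=> cf; elim: (index_enum I) => [|i s IH].
  by under eq_fun do rewrite big_nil; exact: within_continuous_cst.
by under eq_fun do rewrite big_cons; exact: within_continuousD.
Qed.

Lemma within_continuous_comp (S U : topologicalType) (B : set S)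
  (f : T -> S) (g : S -> U) : {within A, continuous f} -> A `<=` f @^-1` B ->
  {within B, continuous g} -> {within A, continuous (g \o f)}.
Proof.
move=> /subspace_continuousP cf AB /subspace_continuousP cg.
apply/subspace_continuousP => x Ax W /= nW.
have H : nbhs x [set y | A y -> B (f y) -> W (g (f y))].
  exact: cf _ Ax _ (cg _ (AB _ Ax) _ nW).
suff : nbhs x [set y | A y -> W (g (f y))] by [].
by apply: filterS H => y h Ay; exact: h Ay (AB _ Ay).
Qed.

End within.

Section path_space.
Variables (R : realType) (d T : nat) (K : 'I_T.+1 -> 'I_d -> set R).
Notation M := 'M[R]_(T.+1, d).
Notation Om := (Omega K).

Definition weight (x : M) : R := 1 + \sum_(t < T.+1) \sum_(j < d) `|x t j|.

Lemma weight_ge1 x : 1 <= weight x.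
Proof. by rewrite lerDl; do 2 (apply: sumr_ge0 => ? _). Qed.

Lemma weight_ge0 x : 0 <= weight x.
Proof. exact: le_trans ler01 (weight_ge1 x). Qed.

Lemma coord_le_weight (x : M) t j : `|x t j| <= weight x.
Proof.
rewrite /weight (bigD1 t)//= (bigD1 j)//= addrCA -addrA lerDl.
by rewrite addr_ge0// ?addr_ge0//; do 2 ?(apply: sumr_ge0 => ? _).
Qed.

(** This is [C(Omega)] of the overview. Values outside [Omega] are unconstrained; a linear
    functional that is positive on [Omega] cannot distinguish functions that agree there. *)
Definition Cw : set (M -> R) := [set g | {within Om, continuous g} /\
  exists a, forall x, Om x -> `|g x| <= a * weight x].

Lemma Cw_lin a f g : Cw f -> Cw g -> Cw (fun x => a * f x + g x).
Proof.
move=> [cf [m fm]] [cg [n gn]]; split.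
  apply: within_continuousD => //; apply: within_continuousM => //.
  exact: within_continuous_cst.
exists (`|a| * m + n) => x Ox; rewrite (le_trans (ler_normD _ _))//.
rewrite mulrDl lerD ?gn// normrM -mulrA; apply: ler_wpM2l => //; exact: fm.
Qed.

Lemma Cw_max f g : Cw f -> Cw g -> Cw (fun x => Num.max (f x) (g x)).
Proof.
move=> [cf [m fm]] [cg [n gn]]; split; first exact: within_continuous_max.
exists (Num.max m n) => x Ox.
have w0 := weight_ge0 x.
by case: (leP (f x) (g x)) => _; [apply: le_trans (gn _ Ox) _|apply: le_trans (fm _ Ox) _];
  rewrite ler_wpM2r// le_max lexx ?orbT.
Qed.

Lemma Cw_cst a : Cw (fun=> a).
Proof.
split; first exact: within_continuous_cst.
by exists `|a| => x _; rewrite ler_peMr// weight_ge1.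
Qed.

Lemma Cw_D f g : Cw f -> Cw g -> Cw (fun x => f x + g x).
Proof. by move=> Cf Cg; have := Cw_lin 1 Cf Cg; under eq_fun do rewrite mul1r. Qed.

Lemma Cw_Z a f : Cw f -> Cw (fun x => a * f x).
Proof.
by move=> Cf; have := Cw_lin a Cf (Cw_cst 0); under eq_fun do rewrite addr0.
Qed.

Lemma Cw_B f g : Cw f -> Cw g -> Cw (fun x => f x - g x).
Proof.
by move=> Cf Cg; have := Cw_lin (-1) Cg Cf; under eq_fun do rewrite mulN1r addrC.
Qed.

Lemma Cw_sum (I : finType) (f : I -> M -> R) :
  (forall i, Cw (f i)) -> Cw (fun x => \sum_i f i x).
Proof.
move=> Cf; elim: (index_enum I) => [|i s IH].
  by under eq_fun do rewrite big_nil; exact: Cw_cst.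
by under eq_fun do rewrite big_cons; exact: Cw_D.
Qed.

Lemma Cw_coord t j : Cw (fun x : M => x t j).
Proof.
split; first by apply: continuous_subspaceT; exact: coord_continuous.
by exists 1 => x _; rewrite mul1r coord_le_weight.
Qed.

Lemma Cw_weight : Cw weight.
Proof.
split; last first.
  by exists 1 => x _; rewrite mul1r ger0_norm// weight_ge0.
apply: within_continuousD; first exact: within_continuous_cst.
do 2 (apply: within_continuous_sum => ?); apply: continuous_subspaceT => x.
by apply: continuous_comp; [exact: coord_continuous|exact: norm_continuous].
Qed.

Lemma extE t (phi : Kpt K t -> R) v (h : Kt K t v) : ext phi v = phi (exist _ v h).
Proof.
rewrite /ext; case: pselect => // h'.
by congr phi; congr exist; exact: Prop_irrelevance.
Qed.

Lemma Cw_ext t (phi : Kpt K t -> R) : inC phi -> Cw (fun x => ext phi (row t x)).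
Proof.
move=> [cphi [m phim]]; split.
  apply: (@within_continuous_comp _ _ _ _ (Kt K t) (row t)) cphi.
    by apply: continuous_subspaceT; exact: row_continuous.
  by move=> x Ox; exact: Ox.
exists `|m| => x Ox; rewrite (extE phi (Ox t)) (le_trans (phim _))//=.
rewrite (@le_trans _ _ (`|m| * (1 + \sum_(j < d) `|x t j|)))//.
  under eq_bigr do rewrite mxE; rewrite ler_wpM2r ?ler_norm// addr_ge0//.
  by apply: sumr_ge0.
rewrite ler_wpM2l// lerD2l (bigD1 t)//= lerDl.
by do 2 (apply: sumr_ge0 => ? _).
Qed.

Definition lift_sum (phi : forall t, Kpt K t -> R) (x : M) : R :=
  \sum_t ext (phi t) (row t x).

Lemma lift_sumE phi x (hx : Om x) :
  lift_sum phi x = \sum_(t < T.+1) phi t (exist _ (row t x) (hx t)).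
Proof. by apply: eq_bigr => t _; exact: extE. Qed.

Lemma Cw_lift_sum phi : (forall t, inC (phi t)) -> Cw (lift_sum phi).
Proof. by move=> Cphi; apply: Cw_sum => t; exact: Cw_ext. Qed.

Lemma Cw_IDelta Delta : inH K Delta -> Cw (IDelta Delta).
Proof.
move=> HD; apply: Cw_sum => t; have [_ [cD [m Dm]]] := HD t.
have OP : Om `<=` Pre K t by move=> x Ox s _; exact: Ox.
apply: Cw_sum => j; split.
  apply: within_continuousM.
    apply: (@within_continuous_comp _ _ _ _ setT (Delta t) (fun v => v ord0 j)) => //.
      exact: continuous_subspaceW cD.
    by apply: continuous_subspaceT; exact: coord_continuous.
  by case: (Cw_B (Cw_coord (lift ord0 t) j) (Cw_coord (widen_ord (leqnSn T) t) j)).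
have [_ [n nP]] := Cw_B (Cw_coord (lift ord0 t) j) (Cw_coord (widen_ord (leqnSn T) t) j).
exists (`|m| * n) => x Ox; rewrite normrM -mulrA ler_pM ?nP//.
by rewrite (le_trans (Dm _ (OP _ Ox) _))// ler_norm.
Qed.

Hypothesis hK : forall t j, closed (K t j).

Lemma closed_Kt t : closed (Kt K t).
Proof.
have -> : Kt K t = \bigcap_(j in setT) ((fun v : 'rV[R]_d => v ord0 j) @^-1` K t j).
  by apply/seteqP; split => v h j => [_|]; exact: h.
apply: closed_bigI => j _; apply: preimage_closed; last exact: hK.
by move=> v _; exact: coord_continuous.
Qed.

Lemma closed_Omega : closed Om.
Proof.
have -> : Om = \bigcap_(t in setT) (row t @^-1` Kt K t).
  by apply/seteqP; split => v h j => [_|]; exact: h.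
apply: closed_bigI => j _; apply: preimage_closed; last exact: closed_Kt.
by move=> v _; exact: row_continuous.
Qed.

End path_space.

(** * Riesz representation on the path space *)

Section representation.
Variables (R : realType) (d T : nat) (K : 'I_T.+1 -> 'I_d -> set R).
Notation M := 'M[R]_(T.+1, d).
Notation Om := (Omega K).
Notation Cw := (Cw K).
Hypothesis hK : forall t j, closed (K t j).

Lemma measurable_Omega : measurable (Om : set (BorelPath R d T)).
Proof.
rewrite -(setCK Om); apply: measurableC; apply: sub_sigma_algebra.
by rewrite openC; exact: closed_Omega.
Qed.

Section riesz.
Variable L : (M -> R) -> R.
Hypothesis Llin : forall a f g, Cw f -> Cw g ->
  L (fun x => a * f x + g x) = a * L f + L g.
Hypothesis Lpos : forall f, Cw f -> (forall x, Om x -> 0 <= f x) -> 0 <= L f.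
Hypothesis L1 : L (fun=> 1) = 1.
Hypothesis Ltight : forall e : R, 0 < e -> exists (B : set M) (F : M -> R),
  [/\ compact B /\ B `<=` Om, Cw F, forall x, Om x -> 0 <= F x,
      forall x, Om x -> ~ B x -> weight x <= F x & L F < e].

(** Tightness supplies a compact [B] and [F] with [L F < e / (2 b)]. Dini's theorem makes
    [h k < e / 2] on [B], while off [B] one has [h k <= h 0 <= b F]. Hence [h k <= b F + e / 2] on
    [Omega]. Taking [b = |a| + 1] ensures [b > 0]. *)
Lemma daniell_continuity (h : nat -> M -> R) : (forall k, Cw (h k)) ->
  (forall k x, Om x -> 0 <= h k.+1 x <= h k x) ->
  (forall x e, Om x -> 0 < e -> exists k, h k x < e) ->
  forall e, 0 < e -> exists k, L (h k) < e.
Proof.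
move=> Ch hdecr hlim e e0.
have [_ [a ha]] := Ch 0%N.
pose b : R := `|a| + 1.
have e20 : 0 < e / 2 by rewrite divr_gt0.
have b0 : 0 < b by rewrite ltr_wpDl.
have [B [F [[cB BO] CF F0 FB LF]]] := Ltight (divr_gt0 e20 b0).
have hdecr' k x : Om x -> h k.+1 x <= h k x by move=> Ox; case/andP: (hdecr k x Ox).
have [k hk] := dini cB BO (fun k => (Ch k).1) hdecr' (fun x Ox => hlim x _ Ox e20).
exists k; have h_le x : Om x -> h k x <= h 0%N x.
  move=> Ox; have /(@nonincreasing_seqP _ _ (h ^~ x)) := fun i => hdecr' i x Ox.
  by apply.
have hle x : Om x -> h k x <= b * F x + e / 2.
  move=> Ox; have [Bx|nBx] := pselect (B x).
    rewrite (le_trans (ltW (hk x Bx)))// lerDr mulr_ge0 ?F0//; exact: ltW.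
  rewrite (le_trans (h_le _ Ox))// (le_trans (ler_norm _))//.
  rewrite (le_trans (ha _ Ox))// -[leLHS]addr0 lerD ?(ltW e20)//.
  have w0 := weight_ge0 x.
  apply: (@le_trans _ _ (b * weight x)).
    by rewrite ler_wpM2r// /b (le_trans (ler_norm _))// lerDl.
  by rewrite ler_pM2l// FB.
have Cbound : Cw (fun x => b * F x + e / 2) by apply: Cw_lin => //; exact: Cw_cst.
have : 0 <= L (fun x => -1 * h k x + (b * F x + e / 2)).
  by apply: Lpos; [exact: Cw_lin|move=> x Ox; rewrite mulN1r addrC subr_ge0 hle].
have Ccst a' : L (fun=> a') = a'.
  have := Llin a' (Cw_cst K 1) (Cw_cst K 0).
  have := Llin (-1) (Cw_cst K 1) (Cw_cst K 1).
  under eq_fun do rewrite mulN1r addNr; rewrite mulN1r addNr => ->.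
  by under eq_fun do rewrite mulr1 addr0; rewrite L1 mulr1 addr0.
rewrite Llin// Llin ?Ccst//; last exact: Cw_cst.
by move: LF; rewrite ltr_pdivlMr// mulrC; lra.
Qed.

Lemma riesz_representation : exists Q : probability (BorelPath R d T) R,
  [/\ Q Om = 1%E,
      forall f, Cw f -> Q.-integrable Om (fun x : BorelPath R d T => (f x)%:E)
    & forall f, Cw f -> (\int[Q]_(x in Om) (f x)%:E = (L f)%:E)%E].
Proof.
apply: daniell_stone => //.
- exact: Cw_cst.
- exact: Cw_lin.
- exact: Cw_max.
- exact: daniell_continuity.
(* On [Omega], an open set is the positivity set of the Lipschitz envelope of its indicator, so the
   generators of the Borel sigma-algebra have the form required by the Daniell-Stone theorem. *)
- move=> U oU; pose b (y : M) : R := \1_U y.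
  have b0 y : Om y -> 0 <= b y by [].
  exists (inf_convolution Om b 1); split.
  + split; first exact: inf_convolution_continuous.
    exists 1 => x Ox; rewrite ger0_norm ?inf_convolution_ge0// mul1r.
    rewrite (le_trans (inf_convolution_le _ _ Ox))//.
    by rewrite (le_trans _ (weight_ge1 x))// /b indicE lern1 leq_b1.
  + by move=> x Ox; exact: inf_convolution_ge0.
  + move=> x Ox; split => [Ux|].
      have /nbhs_ballP[r /= r0 rU] : nbhs x U by exact: open_nbhs_nbhs.
      apply: lt_le_trans (inf_convolution_gt ltr01 b0 (a := 1) Ox r0 _).
        by rewrite lt_min ltr01 mul1r.
      move=> y Oy xy; rewrite /b indicE mem_set//; apply: rU.
      by rewrite -ball_normE.
    move=> /lt_le_trans /(_ (inf_convolution_le ltr01 b0 Ox)).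
    by rewrite /b indicE; case: (boolP (x \in U)) => [/set_mem//|_]; rewrite ltxx.
- exact: measurable_Omega.
- by move=> f [cf _]; apply: measurable_fun_within => //; exact: measurable_Omega.
Qed.

End riesz.
End representation.

(** * Integrals of lower semicontinuous functions *)

(** Positive and negative parts are compared separately, so that infinite integrals are allowed, as
    they must be for [c]. *)
Lemma le_integral_measurable (R : realType) (d : measure_display)
    (X : measurableType d) (mu : {measure set X -> \bar R}) (D : set X)
    (f g : X -> \bar R) : measurable D -> measurable_fun D f -> measurable_fun D g ->
  (forall x, D x -> f x <= g x)%E ->
  (\int[mu]_(x in D) f x <= \int[mu]_(x in D) g x)%E.
Proof.
move=> mD mf mg fg; rewrite integralE [leRHS]integralE leeB//.
- apply: ge0_le_integral => //.
  + exact: measurable_funepos.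
  + exact: measurable_funepos.
  + move=> x Dx; apply: (funepos_le (D := D)); last exact: mem_set.
    by move=> y /set_mem; exact: fg.
- apply: ge0_le_integral => //.
  + exact: measurable_funeneg.
  + exact: measurable_funeneg.
  + move=> x Dx; apply: (funeneg_le (D := D)); last exact: mem_set.
    by move=> y /set_mem; exact: fg.
Qed.

Section lsc.
Variables (R : realType) (d T : nat) (K : 'I_T.+1 -> 'I_d -> set R).
Notation M := 'M[R]_(T.+1, d).
Notation Om := (Omega K).
Notation Cw := (Cw K).
Hypothesis hK : forall t j, closed (K t j).
Variable c : M -> \bar R.
Hypothesis hc : lsc_on Om c.

Lemma measurable_fun_lsc_on :
  measurable_fun (Om : set (BorelPath R d T)) (c : BorelPath R d T -> \bar R).
Proof.
apply: measurable_fun_lsc; first exact: measurable_Omega.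
by move=> x Ox a /(hc Ox)[V nV Vc]; apply: filterS nV => y Vy Oy; exact: Vc.
Qed.

Variable A : R.
Hypothesis cA : forall x, Om x -> ((- A * weight x)%:E <= c x)%E.
Variable Q : probability (BorelPath R d T) R.
Hypothesis Qint : forall f, Cw f ->
  Q.-integrable Om (fun x : BorelPath R d T => (f x)%:E).

Let W (x : M) := A * weight x.
(** Adding the integrable function [W] makes the cost nonnegative, which opens the way to envelopes
    and monotone convergence. *)
Let h (x : M) : \bar R := (c x + (W x)%:E)%E.

Let CW : Cw W.
Proof. by apply: Cw_Z; exact: Cw_weight. Qed.

Let h0 x : Om x -> (0 <= h x)%E.
Proof.
by move=> Ox; rewrite /h -leeBlDr// sub0e (le_trans _ (cA Ox))// lee_fin /W mulNr.
Qed.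

Let hlsc x (a : R) : Om x -> (a%:E < h x)%E -> nbhs x [set y | Om y -> (a%:E < h y)%E].
Proof.
move=> Ox ah.
(* A real level [s] strictly between [a - W x] and [c x] splits the bound into one on [c], kept by
   semicontinuity, and one on [W], kept by continuity. *)
have [s as_ sc] : exists2 s, a < s + W x & (s%:E < c x)%E.
  have := ah; have := h0 Ox; rewrite /h; case: (c x) => [r| |]//.
    rewrite -!EFinD lte_fin => _ arW; exists ((r + a - W x) / 2); last rewrite lte_fin; lra.
  by move=> _ _; exists (a - W x + 1); [lra|rewrite ltry].
have [V nV Vc] := hc Ox sc.
have as_W : a - s < W x by lra.
have nW := within_continuous_nbhs CW.1 Ox (lt_nbhsr as_W).
apply: filterS2 nV nW => y Vy asW Oy.
have {}asW : a - s < W y by exact: asW.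
have := Vc y Vy Oy.
rewrite /h; case: (c y) => [r| |]//; last by move=> _; exact: ltry.
by rewrite -EFinD !lte_fin; lra.
Qed.

(** Capping at [n] makes the values finite; as [h] is nonnegative on [Omega], [fine] never falls
    back to its default there. *)
Let b n (y : M) := fine (mine (h y) n%:R%:E).

Let bE n y : Om y -> (b n y)%:E = mine (h y) n%:R%:E.
Proof.
move=> Oy; rewrite /b fineK//; have := h0 Oy.
by case: (h y) => [r| |]// _; rewrite /mine; case: ifP; rewrite // ltNge leey.
Qed.

Let b0 n y : Om y -> 0 <= b n y.
Proof.
by move=> Oy; rewrite -lee_fin bE// le_min h0//= lee_fin ler0n.
Qed.

(** Cap and slope grow together, so [g n] increases to [h]. The slope is [n + 1] because it must be
    positive already at [n = 0]. *)
Let g n := inf_convolution Om (b n) n.+1%:R.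

Let g_mono n m x : Om x -> (n <= m)%N -> g n x <= g m x.
Proof.
move=> Ox nm; apply: le_inf_convolution => //; first exact: b0.
  move=> y Oy; rewrite -lee_fin !bE// le_min !ge_min lexx/=.
  by rewrite lee_fin ler_nat nm orbT.
by rewrite ler_nat ltnS.
Qed.

Let g_ge0 n x : Om x -> 0 <= g n x.
Proof. by move=> Ox; apply: inf_convolution_ge0 => //; exact: b0. Qed.

Let g_le_b n x : Om x -> g n x <= b n x.
Proof. by move=> Ox; apply: inf_convolution_le => //; exact: b0. Qed.

Let g_le_h n x : Om x -> ((g n x)%:E <= h x)%E.
Proof.
move=> Ox; apply: (@le_trans _ _ (b n x)%:E); first by rewrite lee_fin g_le_b.
by rewrite bE// ge_min lexx.
Qed.

Let Cg n : Cw (g n).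
Proof.
split; first by apply: inf_convolution_continuous => //; exact: b0.
exists n%:R => x Ox; rewrite ger0_norm ?g_ge0//.
rewrite (le_trans (g_le_b n Ox))// (@le_trans _ _ n%:R)//.
  by rewrite -lee_fin bE// ge_min lexx orbT.
by rewrite ler_peMr// weight_ge1.
Qed.

Let g_cvg x : Om x -> ((g n x)%:E @[n --> \oo] --> h x)%E.
Proof.
move=> Ox; have nd : nondecreasing_seq (fun n => (g n x)%:E).
  by move=> n m nm; rewrite lee_fin g_mono.
suff -> : h x = ereal_sup (range (fun n => (g n x)%:E)).
  exact: ereal_nondecreasing_cvgn.
apply/eqP; rewrite eq_le; apply/andP; split; last first.
  by apply: ge_ereal_sup => _ [n _ <-]; exact: g_le_h.
have key (a : R) : (a%:E < h x)%E -> (a%:E <= ereal_sup (range (fun n => (g n x)%:E)))%E.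
  move=> ah; have [a0|a0] := ltP a 0.
    apply: (@le_trans _ _ (g 0%N x)%:E); last by apply: ereal_sup_ubound; exists 0%N.
    by rewrite lee_fin (le_trans (ltW a0))// g_ge0.
  have /nbhs_ballP[r /= r0 rh] := hlsc Ox ah.
  (* The cap must not cut below [a], and the penalty [(n + 1) r] at distance [r] must reach [a]. *)
  pose n := maxn (Num.truncn a).+1 (Num.truncn (a / r)).+1.
  have an : a <= n%:R.
    by rewrite (le_trans (ltW (truncnS_gt a)))// ler_nat leq_maxl.
  have arn : a <= n.+1%:R * r.
    rewrite -ler_pdivrMr// (le_trans (ltW (truncnS_gt (a / r))))// ler_nat.
    by rewrite leqW// leq_maxr.
  apply: (@le_trans _ _ (g n x)%:E); last by apply: ereal_sup_ubound; exists n.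
  rewrite lee_fin; apply: le_trans (inf_convolution_gt _ (@b0 n) (a := a) Ox r0 _) => //.
    by rewrite le_min lexx.
  move=> y Oy xy; rewrite -lee_fin bE// le_min lee_fin an andbT ltW//.
  by apply: rh => //; rewrite -ball_normE.
move: key; have := h0 Ox; case: (h x) => [r _ key| _ key|]//.
  apply/lee_subgt0Pr => e e0; rewrite -EFinB; apply: key.
  by rewrite lte_fin ltrBlDr ltrDl.
rewrite leye_eq; apply/eqP/eqyP => a _; apply: key; exact: ltry.
Qed.

(** Each [g n - W] is a minorant of [c] in [C(Omega)], so the integral of [g n] is at most [B] plus
    that of [W]. Monotone convergence passes this bound to [h], and the finite integral of [W] is
    subtracted again. *)
Lemma integral_lsc_le (B : R) :
  (forall f, Cw f -> (forall x, Om x -> ((f x)%:E <= c x)%E) ->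
     (\int[Q]_(x in Om) (f x)%:E <= B%:E)%E) ->
  (\int[Q]_(x in Om) c x <= B%:E)%E.
Proof.
move=> hB; have mOm := measurable_Omega hK.
have mCw f : Cw f -> measurable_fun (Om : set (BorelPath R d T))
    (fun x : BorelPath R d T => (f x)%:E).
  by move=> /Qint /integrableP[].
pose w := (\int[Q]_(x in Om) (W x)%:E)%E.
have [v wE] : exists v, w = v%:E.
  exists (fine w); rewrite fineK//; exact: integrable_fin_num (Qint CW).
have gle n : (\int[Q]_(x in Om) (g n x)%:E <= (B + v)%:E)%E.
  have -> : (\int[Q]_(x in Om) (g n x)%:E =
             \int[Q]_(x in Om) ((g n x - W x)%:E + (W x)%:E))%E.
    by apply: eq_integral => x _; rewrite -EFinD subrK.
  have CgW : Cw (fun x => g n x - W x) by exact: Cw_B.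
  rewrite integralD//=; [|exact: (Qint CgW)|exact: (Qint CW)].
  rewrite [X in (_ + X)%E]wE EFinD leeD2r//; apply: hB => //.
  by move=> x Ox; rewrite EFinB leeBlDr//; exact: g_le_h.
have mh : measurable_fun (Om : set (BorelPath R d T)) h.
  by apply: emeasurable_funD; [exact: measurable_fun_lsc_on|exact: mCw].
have cvg_h : (\int[Q]_(x in Om) (g n x)%:E @[n --> \oo] --> \int[Q]_(x in Om) h x)%E.
  have -> : (\int[Q]_(x in Om) h x = \int[Q]_(x in Om) limn (fun n => (g n x)%:E))%E.
    by apply: eq_integral => x /set_mem Ox; apply/esym/cvg_lim => //; exact: g_cvg.
  apply: cvg_monotone_convergence => //.
  - by move=> n; exact: mCw (Cg n).
  - by move=> x Ox n m nm; rewrite lee_fin g_mono.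
have hle : (\int[Q]_(x in Om) h x <= (B + v)%:E)%E.
  rewrite -(cvg_lim _ cvg_h)//; apply: lime_le.
    by apply/cvg_ex; eexists; exact: cvg_h.
  exact: nearW.
have hint : Q.-integrable Om (h : BorelPath R d T -> \bar R).
  apply/integrableP; split => //.
  apply: le_lt_trans (ltry (B + v)); apply: le_trans hle.
  rewrite le_eqVlt; apply/orP; left; apply/eqP.
  by apply: eq_integral => x /set_mem Ox; rewrite gee0_abs// h0.
have -> : (\int[Q]_(x in Om) c x = \int[Q]_(x in Om) (h x - (W x)%:E))%E.
  by apply: eq_integral => x _; rewrite /h addeK.
rewrite integralB//=; last exact: (Qint CW).
by rewrite [X in (_ - X)%E]wE leeBlDr// -EFinD.
Qed.

End lsc.

(** * Marginals *)

(** Freezing all coordinates but one at [x0] shows that each supremum is finite. Near-maximizers,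
    one per coordinate with error [e / (n + 1)], are then combined into a single point. *)
Lemma sum_ereal_sup_le (R : realType) (n : nat) (X : 'I_n -> Type)
    (P : forall t, set (X t)) (a : forall t, X t -> R) (x0 : forall t, X t) (B : R) :
  (forall t, P t (x0 t)) ->
  (forall x : forall t, X t, (forall t, P t (x t)) -> \sum_t a t (x t) <= B) ->
  (\sum_t ereal_sup [set (a t x)%:E | x in P t] <= B%:E)%E.
Proof.
move=> Px0 HB; pose s t := ereal_sup [set (a t x)%:E | x in P t].
have [r rE] : exists r : 'I_n -> R, forall t, s t = (r t)%:E.
  suff /choice[r rP] : forall t, exists r, s t = r%:E by exists r.
  move=> t.
  have sge : ((a t (x0 t))%:E <= s t)%E by apply: ereal_sup_ubound; exists (x0 t).
  have sle : (s t <= (B - \sum_(i | i != t) a i (x0 i))%:E)%E.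
    apply: ge_ereal_sup => _ [x Ptx <-]; rewrite lee_fin lerBrDr.
    pose y := dfwith x0 t x.
    have Py i : P i (y i) by rewrite /y; case: dfwithP.
    have yt : y t = x by exact: dfwithin.
    have yi i : i != t -> y i = x0 i by move=> it; apply: dfwithout; rewrite eq_sym.
    apply: le_trans (HB _ Py); rewrite [leRHS](bigD1 t)//= yt lerD2l.
    by apply: ler_sum => i it; rewrite yi.
  by move: sge sle; case: (s t) => [r| |]//; exists r.
rewrite (eq_bigr (fun t => (r t)%:E)) => [|t _]; last exact: rE.
rewrite sumEFin lee_fin; apply/ler_addgt0Pr => e e0.
have en0 : 0 < e / n.+1%:R by rewrite divr_gt0.
have /(_ _)/cid-/all_sig[x xP] t : exists x, P t x /\ r t - e / n.+1%:R <= a t x.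
  have : ((r t - e / n.+1%:R)%:E < s t)%E by rewrite rE lte_fin ltrBlDr ltrDl.
  by move=> /ereal_sup_gt[_ [x Px <-]]; rewrite lte_fin => /ltW; exists x.
have : \sum_t (r t - e / n.+1%:R) <= B.
  by apply: le_trans (HB x (fun t => (xP t).1)); apply: ler_sum => t _; exact: (xP t).2.
rewrite sumrB lerBlDr => /le_trans; apply.
rewrite lerD2l sumr_const card_ord -(mulr_natr (e / _)) mulrAC ler_pdivrMr//.
by rewrite ler_pM2l// ler_nat.
Qed.

Section probability_on_paths.
Variables (R : realType) (d T : nat) (K : 'I_T.+1 -> 'I_d -> set R).
Notation M := 'M[R]_(T.+1, d).
Notation Om := (Omega K).
Notation Cw := (Cw K).
Hypothesis hK : forall t j, closed (K t j).
Variable Q : probability (BorelPath R d T) R.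
Notation IQ := (fun f : M -> R => \int[Q]_(x in Om) (f x)%:E)%E.

Lemma Prob1_integrable (f : M -> R) : Prob1 K Q -> Cw f ->
  Q.-integrable Om (fun x : BorelPath R d T => (f x)%:E).
Proof.
move=> [Q1 Qcoord] [cf [a fa]]; have mOm := measurable_Omega hK.
have iw : Q.-integrable Om (fun x : BorelPath R d T => (weight x)%:E).
  have -> : (fun x : BorelPath R d T => (weight x)%:E) = (fun x => 1%:E +
      \sum_(t < T.+1) \sum_(j < d) (`|x t j|)%:E)%E.
    by apply/funext => x; rewrite /weight EFinD; congr (_ + _)%E;
      rewrite -sumEFin; apply: eq_bigr => t _; rewrite -sumEFin.
  apply: integrableD => //; first exact: finite_measure_integrable_cst.
  apply: integrable_sum => // t _; apply: integrable_sum => // j _.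
  exact: integrable_abse (Qcoord t j).
apply: (le_integrable mOm _ _ (integrableZl mOm `|a| iw)).
  by apply/measurable_EFinP; exact: measurable_fun_within.
move=> x Ox; rewrite /= lee_fin (le_trans (fa _ Ox))// normrM normr_id.
have w0 := weight_ge0 x.
by rewrite (ger0_norm w0) ler_wpM2r// ler_norm.
Qed.

Lemma measurable_row t :
  measurable_fun setT (fun x : BorelPath R d T => (row t x : BorelRow R d)).
Proof.
apply: (@measurability _ _ (BorelPath R d T) (BorelRow R d) setT
  (fun x => row t x) (@open 'rV[R]_d)) => //.
move=> _ [U oU <-]; rewrite setTI; apply: sub_sigma_algebra.
by move/continuousP: (@row_continuous R T.+1 d t); exact.
Qed.

Lemma measurable_Kt t : measurable (Kt K t : set (BorelRow R d)).
Proof.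
rewrite -(setCK (Kt K t)); apply: measurableC; apply: sub_sigma_algebra.
by rewrite openC; exact: closed_Kt.
Qed.

(** Change of variables gives an integral over the paths whose row [t] alone is constrained. This
    set is larger than [Omega], but only by a [Q]-null set. *)
Lemma integral_marginal t (phi : Kpt K t -> R) : Q Om = 1%E -> inC phi ->
  Q.-integrable Om (fun x : BorelPath R d T => (ext phi (row t x))%:E) ->
  (\int[marginal Q t]_(v in Kt K t) (ext phi v)%:E = IQ (fun x => ext phi (row t x)))%E.
Proof.
move=> Q1 [cphi _] iphi; have mOm := measurable_Omega hK.
have mphi : measurable_fun setT (fun v : BorelRow R d => (ext phi v)%:E).
  have /(measurable_restrictT _ (measurable_Kt t)) :
      measurable_fun (Kt K t : set (BorelRow R d)) (fun v : BorelRow R d => (ext phi v)%:E).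
    apply/measurable_EFinP; apply: measurable_fun_within => //.
    exact: measurable_Kt.
  congr (measurable_fun _ _); apply/funext => v; rewrite patchE.
  case: ifPn => // /negP; rewrite inE /ext; case: pselect => //.
pose D := (fun x : BorelPath R d T => (row t x : BorelRow R d)) @^-1` Kt K t.
have mD : measurable D by rewrite -[D]setTI; exact: measurable_row (measurable_Kt t).
have OD : Om `<=` D by move=> x; exact.
have N0 : Q (D `\` Om) = 0%E.
  have := probability_setC Q mOm; rewrite Q1 subee// => QC0.
  apply/eqP; rewrite eq_le measure_ge0 andbT -QC0.
  by apply: le_measure; rewrite ?inE; [exact: measurableD|exact: measurableC|move=> x []].
have mcomp : measurable_fun D (fun x : BorelPath R d T => (ext phi (row t x))%:E).
  apply: measurable_funTS.
  exact: (measurableT_comp mphi (measurable_row t)).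
have DO : D `\` (D `\` Om) = Om.
  by rewrite setDD; apply/setIidr.
have iD : Q.-integrable D (fun x : BorelPath R d T => (ext phi (row t x))%:E).
  apply/(negligible_integrable (measurableD mD mOm) mD mcomp N0).
  by rewrite DO.
rewrite /marginal integral_pushforward//=; last 2 first.
- exact: measurable_row.
- exact: measurable_Kt.
rewrite (negligible_integral (measurableD mD mOm) mD iD N0).
by rewrite DO.
Qed.

End probability_on_paths.

(** * Duality *)

(** If [b] were negative, [k = (|a| + 1) / (- b)] would give [k b = - (|a| + 1) < a]. *)
Lemma ge0_of_lower_bound (R : realFieldType) (a b : R) : (forall k, 0 <= k -> a <= k * b) -> 0 <= b.
Proof.
move=> H; rewrite leNgt; apply/negP => b0.
have := H ((`|a| + 1) / - b); rewrite invrN mulrN mulNr divfK ?lt_eqF//.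
have := ler_norm (- a); rewrite normrN => h1 h2.
have : a <= - (`|a| + 1) by apply: h2; rewrite -mulrN -invrN divr_ge0// oppr_ge0 ltW.
by lra.
Qed.

Lemma eq0_of_lower_bound (R : realFieldType) (a b : R) : (forall k, a <= k * b) -> b = 0.
Proof.
move=> H; apply/eqP; rewrite eq_le; apply/andP; split.
  rewrite -oppr_ge0; apply: (@ge0_of_lower_bound _ a) => k _.
  by rewrite mulrN -mulNr.
exact: (@ge0_of_lower_bound _ a).
Qed.

(** * Linear operations on hedges and strategies *)

Section lifts.
Variables (R : realType) (d T : nat) (K : 'I_T.+1 -> 'I_d -> set R).
Notation M := 'M[R]_(T.+1, d).
Notation Om := (Omega K).

Lemma lift_sum_comb (a b : R) (phi psi : forall t, Kpt K t -> R) x :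
  lift_sum (fun t v => a * phi t v + b * psi t v) x =
  a * lift_sum phi x + b * lift_sum psi x.
Proof.
rewrite /lift_sum !mulr_sumr -big_split/=; apply: eq_bigr => t _.
by rewrite /ext; case: pselect => //; rewrite !mulr0 addr0.
Qed.

Lemma lift_sumZ (a : R) (phi : forall t, Kpt K t -> R) x :
  lift_sum (fun t v => a * phi t v) x = a * lift_sum phi x.
Proof.
rewrite /lift_sum mulr_sumr; apply: eq_bigr => t _.
by rewrite /ext; case: pselect => //; rewrite mulr0.
Qed.

Lemma lift_sum_addc (phi : forall t, Kpt K t -> R) (k : R) x : Om x ->
  lift_sum (fun t v => phi t v + k) x = lift_sum phi x + T.+1%:R * k.
Proof.
move=> Ox; rewrite !(lift_sumE _ Ox) big_split/=; congr (_ + _).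
by rewrite sumr_const card_ord mulr_natl.
Qed.

Lemma IDelta_comb (a b : R) (Delta Delta' : 'I_T -> M -> 'rV[R]_d) x :
  IDelta (fun t y => a *: Delta t y + b *: Delta' t y) x =
  a * IDelta Delta x + b * IDelta Delta' x.
Proof.
rewrite /IDelta !mulr_sumr -big_split; apply: eq_bigr => t _ /=.
rewrite !mulr_sumr -big_split; apply: eq_bigr => j _ /=.
by rewrite !mxE; ring.
Qed.

Lemma IDeltaZ (a : R) (Delta : 'I_T -> M -> 'rV[R]_d) x :
  IDelta (fun t y => a *: Delta t y) x = a * IDelta Delta x.
Proof.
rewrite /IDelta !mulr_sumr; apply: eq_bigr => t _ /=.
by rewrite !mulr_sumr; apply: eq_bigr => j _ /=; rewrite !mxE mulrA.
Qed.

Lemma IDelta0 (x : M) : IDelta (fun _ _ => 0) x = 0.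
Proof. by rewrite /IDelta big1// => t _; rewrite big1// => j _; rewrite mxE mul0r. Qed.

Lemma inH0 : inH K (fun _ _ => 0).
Proof.
move=> t; split => //; split; first by move=> x; exact: cvg_cst.
by exists 0 => x _ j; rewrite mxE normr0.
Qed.

Lemma inH_comb (a b : R) (Delta Delta' : 'I_T -> M -> 'rV[R]_d) :
  inH K Delta -> inH K Delta' -> inH K (fun t y => a *: Delta t y + b *: Delta' t y).
Proof.
move=> H H' t; have [D1 [D2 [m D3]]] := H t; have [D1' [D2' [m' D3']]] := H' t.
split; first by move=> x y xy; rewrite (D1 x y xy) (D1' x y xy).
split.
  move=> x; apply: cvgD; apply: cvgZ; try exact: cvg_cst.
    exact: D2.
  exact: D2'.
exists (`|a| * m + `|b| * m') => x Px j; rewrite !mxE.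
by rewrite (le_trans (ler_normD _ _))// !normrM lerD// ler_wpM2l ?D3 ?D3'.
Qed.

Lemma inHZ (a : R) (Delta : 'I_T -> M -> 'rV[R]_d) :
  inH K Delta -> inH K (fun t y => a *: Delta t y).
Proof.
move=> H t; have [D1 [D2 [m D3]]] := H t.
split; first by move=> x y xy; rewrite (D1 x y xy).
split; first by move=> x; apply: cvgZ; [exact: cvg_cst|exact: D2].
by exists (`|a| * m) => x Px j; rewrite !mxE normrM ler_wpM2l ?D3.
Qed.

End lifts.

Section duality.
Variables (R : realType) (d T : nat) (K : 'I_T.+1 -> 'I_d -> set R).
Notation M := 'M[R]_(T.+1, d).
Notation Om := (Omega K).
Notation Cw := (Cw K).
Hypothesis hK : forall t j, closed (K t j).
Unset Implicit Arguments.
Variable E : forall t : 'I_T.+1, set (Kpt K t -> R).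
Variable S : forall t : 'I_T.+1, (Kpt K t -> R) -> R.
Set Implicit Arguments.
Hypothesis hEC : forall t phi, E t phi -> inC phi.
Variable c : M -> \bar R.
Hypothesis hc : lsc_on Om c.

(* [phi] and [Delta] are dominated by [c + h]; [h] is subtracted on the left since
   [c] may take the value [+oo]. *)
Definition superhedge (phi : forall t, Kpt K t -> R) (Delta : 'I_T -> M -> 'rV[R]_d)
    (h : M -> R) : Prop :=
  [/\ forall t, E t (phi t), inH K Delta &
      forall x, Om x -> ((lift_sum phi x + IDelta Delta x - h x)%:E <= c x)%E].

(** The integrals [i t] of the components are finite, so they may be added and subtracted even when
    the cost or the penalties have infinite value. *)
Lemma weak_duality phi Delta (Q : probability (BorelPath R d T) R) :
  superhedge phi Delta (fun=> 0) -> Mart K Q ->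
  ((Ufun S phi)%:E <= \int[Q]_(x in Om) c x + \sum_(t < T.+1) Dt E S t (marginal Q t))%E.
Proof.
move=> [Ephi HD le_c] [P1 QD]; have mOm := measurable_Omega hK.
have iC f : Cw f -> Q.-integrable Om (fun x : BorelPath R d T => (f x)%:E).
  exact: Prob1_integrable.
have Cphi t : Cw (fun x => ext (phi t) (row t x)) by apply: Cw_ext; exact: hEC.
have /choice[i iE] t : exists r,
    (\int[Q]_(x in Om) (ext (phi t) (row t x))%:E = r%:E)%E.
  exists (fine (\int[Q]_(x in Om) (ext (phi t) (row t x))%:E)).
  by rewrite fineK//; exact: integrable_fin_num (iC _ (Cphi t)).
have Dge t : ((S t (phi t) - i t)%:E <= Dt E S t (marginal Q t))%E.
  apply: ereal_sup_ubound; exists (phi t) => //.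
  by rewrite integral_marginal ?iE//; [exact: P1.1|exact: hEC|exact: iC].
have Cphis : Cw (lift_sum phi) by apply: Cw_lift_sum => t; exact: hEC.
have CI := Cw_IDelta HD.
have sumi : ((\sum_t i t)%:E <= \int[Q]_(x in Om) c x)%E.
  have -> : (\sum_t i t)%:E = (\int[Q]_(x in Om) ((lift_sum phi x)%:E + (IDelta Delta x)%:E))%E.
    rewrite integralD//=; [|exact: (iC _ Cphis)|exact: (iC _ CI)].
    rewrite QD// adde0 /lift_sum.
    rewrite (eq_integral (fun x : BorelPath R d T =>
        (\sum_(t < T.+1) (ext (phi t) (row t x))%:E)%E)); last first.
      by move=> x _; rewrite sumEFin.
    rewrite integral_sum//; last by move=> t; exact: (iC _ (Cphi t)).
    by rewrite -sumEFin; apply: eq_bigr => t _; rewrite iE.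
  apply: le_integral_measurable => //.
  - have /integrableP[] // := iC _ (Cw_D Cphis CI).
  - exact: measurable_fun_lsc_on.
  - by move=> x Ox; have := le_c x Ox; rewrite subr0 EFinD.
have -> : Ufun S phi = \sum_t i t + \sum_t (S t (phi t) - i t).
  by rewrite sumrB addrC subrK.
rewrite EFinD; apply: leeD => //.
by rewrite -sumEFin; apply: lee_sum => t _; exact: Dge.
Qed.

Hypothesis hE0 : forall t, E t (fun=> 0).
Hypothesis hEadd : forall t phi psi, E t phi -> E t psi -> E t (fun v => phi v + psi v).
Hypothesis hEscale : forall t (a : R) phi, E t phi -> E t (fun v => a * phi v).
Hypothesis hEcst : forall t phi (k : R), E t phi -> E t (fun v => phi v + k).
Hypothesis hSconc : forall t phi psi (l : R), E t phi -> E t psi -> 0 <= l <= 1 ->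
  l * S t phi + (1 - l) * S t psi <= S t (fun v => l * phi v + (1 - l) * psi v).
Hypothesis hScash : forall t phi (k : R), E t phi ->
  S t (fun v => phi v + k) = S t phi + k.
Unset Implicit Arguments.
Variables (KK : 'I_T.+1 -> nat -> set 'rV[R]_d)
  (f : forall t : 'I_T.+1, nat -> Kpt K t -> R).
Set Implicit Arguments.
Hypothesis hKf : forall t n, compact (KK t n) /\ KK t n `<=` Kt K t /\
  E t (f t n) /\ forall v, 0 <= f t n v.
Hypothesis hf_growth : forall n x (hx : Om x), ~ (forall t, KK t n (row t x)) ->
  weight x <= \sum_(t < T.+1) f t n (exist _ (row t x) (hx t)).
Hypothesis hVf : forall Gamma : R, 0 < Gamma ->
  (fun n => Vfun S (fun t v => Gamma * f t n v)) @ \oo --> 0.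
Variable A : R.
Hypothesis A0 : 0 <= A.
Hypothesis cA : forall x, Om x -> ((- A * weight x)%:E <= c x)%E.

Let F n := lift_sum (fun t => f t n).

Let CF n : Cw (F n).
Proof. by apply: Cw_lift_sum => t; apply: hEC; have [_ [_ []]] := hKf t n. Qed.

Let F0 n x : Om x -> 0 <= F n x.
Proof.
by move=> Ox; rewrite /F (lift_sumE _ Ox) sumr_ge0// => t _; have [_ [_ [_]]] := hKf t n.
Qed.

Let B n := [set x : M | forall t, KK t n (row t x)].

Let compactB n : compact (B n).
Proof. by apply: (@compact_rows _ _ _ (fun t => KK t n)) => t; have [] := hKf t n. Qed.

Let BOm n : B n `<=` Om.
Proof. by move=> x Bx t; have [_ [+ _]] := hKf t n; apply; exact: Bx. Qed.

Let weight_le_F n x : Om x -> ~ B n x -> weight x <= F n x.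
Proof. by move=> Ox nBx; rewrite /F (lift_sumE _ Ox); exact: hf_growth. Qed.

(** The growth condition off a compact set and boundedness on it give [weight <= F 0 + b]. A
    multiple of the right side by [g = A + |a|] therefore absorbs the lower bound of [c] together
    with [h]. *)
Lemma superhedge_exists h : Cw h -> exists phi, superhedge phi (fun _ _ => 0) h.
Proof.
move=> [_ [a ha]].
have [b b0 bP] : exists2 b, 0 <= b & forall x, Om x -> weight x <= F 0%N x + b.
  have cw : compact (@weight R d T @` B 0).
    apply: continuous_compact; last exact: compactB.
    by apply: continuous_subspaceW (Cw_weight K).1; exact: BOm.
  have [N [_ HN]] := compact_bounded cw.
  exists (`|N| + 1); first by rewrite addr_ge0.
  move=> x Ox; have [Bx|nBx] := pselect (B 0 x); last first.
    by rewrite (le_trans (weight_le_F Ox nBx))// lerDl addr_ge0.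
  rewrite (le_trans (ler_norm _))// ler_wpDl ?F0//.
  apply: HN; last by exists x.
  by rewrite (le_lt_trans (ler_norm _))// ltrDl.
pose g := A + `|a|.
have g0 : 0 <= g by rewrite addr_ge0.
(* The constant is subtracted in each component, in total [(T + 1) g b], which is at least the
   required [g b]. *)
exists (fun t v => - g * f t 0%N v + - (g * b)); split; [|exact: inH0|].
  by move=> t; apply/hEcst/hEscale; have [_ [_ []]] := hKf t 0%N.
move=> x Ox; apply: le_trans (cA Ox); rewrite lee_fin IDelta0 addr0.
rewrite lift_sum_addc// lift_sumZ -/(F 0%N).
have hx : - h x <= `|a| * weight x.
  rewrite (le_trans (ler_norm _))// normrN (le_trans (ha _ Ox))//.
  by rewrite ler_wpM2r ?ler_norm// weight_ge0.
have : g * weight x <= g * (F 0%N x + b) by rewrite ler_wpM2l// bP.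
have : g * b <= T.+1%:R * (g * b) by rewrite ler_peMl ?mulr_ge0// ler1n.
by rewrite /g in g0 *; move: hx; rewrite !mulNr mulrN !mulrDl !mulrDr; lra.
Qed.

Let U_concave phi psi l : (forall t, E t (phi t)) -> (forall t, E t (psi t)) ->
  0 <= l <= 1 -> l * Ufun S phi + (1 - l) * Ufun S psi <=
  Ufun S (fun t v => l * phi t v + (1 - l) * psi t v).
Proof.
move=> Ephi Epsi l01; rewrite /Ufun !mulr_sumr -big_split/=.
by apply: ler_sum => t _; exact: hSconc.
Qed.

Let superhedge_comb phi psi D D' h h' l : superhedge phi D h ->
  superhedge psi D' h' -> 0 <= l <= 1 ->
  superhedge (fun t v => l * phi t v + (1 - l) * psi t v)
    (fun t y => l *: D t y + (1 - l) *: D' t y)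
    (fun x => l * h x + (1 - l) * h' x).
Proof.
move=> [Ep HD le1] [Ep' HD' le2] /andP[l0 l1]; split.
- by move=> t; apply: hEadd; exact: hEscale.
- exact: inH_comb.
- move=> x Ox; rewrite lift_sum_comb IDelta_comb.
  have := le1 x Ox; have := le2 x Ox; have := cA Ox.
  case: (c x) => [r| |]//; last by move=> _ _ _; exact: leey.
  rewrite !lee_fin => _ le2' le1'.
  set p := lift_sum phi x in le1' *; set q := lift_sum psi x in le2' *.
  set i := IDelta D x in le1' *; set j := IDelta D' x in le2' *.
  have h1 : l * (p + i - h x) <= l * r by rewrite ler_wpM2l.
  have h2 : (1 - l) * (q + j - h' x) <= (1 - l) * r.
    by rewrite ler_wpM2l// subr_ge0.
  by move: h1 h2; lra.
Qed.

Variable p : R.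
Hypothesis hp : forall phi Delta, superhedge phi Delta (fun=> 0) -> Ufun S phi <= p.

(** A fixed hedge [phi0] of [c] also hedges [c + k u] for [u >= 0] and [k >= 0]; after adding cash
    [k] it hedges [c + k], and with strategy [k Delta] it hedges [c + k I^Delta]. Domination for all
    such [k] gives positivity, normalization and the vanishing on [I^Delta]. *)
Lemma superhedging_price_functional : exists L : (M -> R) -> R,
  [/\ forall a u v, Cw u -> Cw v -> L (fun x => a * u x + v x) = a * L u + L v,
      forall u, Cw u -> (forall x, Om x -> 0 <= u x) -> 0 <= L u,
      L (fun=> 1) = 1,
      forall Delta, inH K Delta -> L (IDelta Delta) = 0
    & forall phi g, (forall t, E t (phi t)) -> Cw g ->
        (forall x, Om x -> ((g x)%:E <= c x)%E) ->
        Ufun S phi - p <= L (lift_sum phi) - L g].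
Proof.
pose V : lmodType R := M -> R^o.
pose C : set V := Cw.
pose hypo (h : V) r := exists phi Delta, superhedge phi Delta h /\ r <= Ufun S phi - p.
have [L [Llin Ldom]] : exists L : V -> R,
    (forall a u v, C u -> C v -> L (a *: u + v) = a * L u + L v) /\
    (forall u r, C u -> hypo u r -> r <= L u).
  apply: hahn_banach_separation.
  - by move=> a u v; exact: Cw_lin.
  - move=> u v r s l Cu Cv [phi [D [sp rp]]] [psi [D' [sp' rp']]] l01.
    exists (fun t v => l * phi t v + (1 - l) * psi t v).
    exists (fun t y => l *: D t y + (1 - l) *: D' t y); split.
      exact: (superhedge_comb sp sp').
    have [[Ep _ _] [Ep' _ _]] := (sp, sp').
    apply: le_trans (lerD (U_concave Ep Ep' l01) (lexx (- p))).
    have /andP[l0 l1] := l01.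
    have := ler_wpM2l l0 rp.
    have l1' : 0 <= 1 - l by rewrite subr_ge0.
    have := ler_wpM2l l1' rp'; set u1 := Ufun S phi; set u2 := Ufun S psi.
    have -> : l * u1 + (1 - l) * u2 - p = l * (u1 - p) + (1 - l) * (u2 - p) by ring.
    by lra.
  - move=> u /superhedge_exists[phi sp]; exists (Ufun S phi - p).
    by exists phi, (fun _ _ => 0).
  - move=> r [phi [D [sp rp]]]; rewrite (le_trans rp)// subr_le0.
    exact: hp sp.
have [phi0 sp0] := superhedge_exists (Cw_cst K 0).
have [Ephi0 _ le0] := sp0.
have Llin' a u v : Cw u -> Cw v -> L (fun x => a * u x + v x) = a * L u + L v.
  exact: Llin.
have C0 := Cw_cst K 0.
have L0 : L (fun=> 0) = 0.
  have := Llin' (-1) _ _ C0 C0.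
  by under eq_fun do rewrite mulr0 addr0; rewrite mulN1r addNr.
have LZ k u : Cw u -> L (fun x => k * u x) = k * L u.
  move=> Cu; have := Llin' k _ _ Cu C0.
  by under eq_fun do rewrite addr0; rewrite L0 addr0.
have LB u v : Cw u -> Cw v -> L (fun x => u x - v x) = L u - L v.
  move=> Cu Cv; have := Llin' (-1) _ _ Cv Cu.
  by under eq_fun do rewrite mulN1r addrC; rewrite mulN1r addrC.
have dom u phi D : Cw u -> superhedge phi D u -> Ufun S phi - p <= L u.
  by move=> Cu sp; apply: Ldom => //; exists phi, D.
exists L; split.
- exact: Llin'.
- move=> u Cu u0; apply: (@ge0_of_lower_bound _ (Ufun S phi0 - p)) => k k0.
  rewrite -LZ//; apply: (dom _ _ (fun _ _ => 0)); first exact: Cw_Z.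
  split; [by []|exact: inH0|].
  move=> x Ox; apply: le_trans (le0 x Ox); rewrite lee_fin lerB// mulr_ge0//.
  exact: u0.
- apply/eqP; rewrite -subr_eq0; apply/eqP.
  apply: (@eq0_of_lower_bound _ (Ufun S phi0 - p)) => k.
  (* The amount [k] is spread evenly over the [T + 1] components, each of which is cash additive. *)
  pose k' := k / T.+1%:R.
  have kE : T.+1%:R * k' = k by rewrite /k' mulrC divfK// pnatr_eq0.
  have := dom (fun=> k * 1) (fun t v => phi0 t v + k') (fun _ _ => 0) (Cw_Z k (Cw_cst K 1)).
  have -> : Ufun S (fun t v => phi0 t v + k') = Ufun S phi0 + k.
    rewrite /Ufun (eq_bigr (fun t => S t (phi0 t) + k')) => [|t _]; last exact: hScash.
    by rewrite big_split/= sumr_const card_ord -(mulr_natl k') kE.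
  rewrite LZ//; last exact: Cw_cst.
  suff sp : superhedge (fun t v => phi0 t v + k') (fun _ _ => 0) (fun=> k * 1).
    by move=> /(_ sp); lra.
  split; [by move=> t; exact: hEcst|exact: inH0|move=> x Ox].
  apply: le_trans (le0 x Ox); rewrite lee_fin lift_sum_addc// kE !IDelta0; lra.
- move=> D HD; apply: (@eq0_of_lower_bound _ (Ufun S phi0 - p)) => k.
  rewrite -LZ; last exact: Cw_IDelta.
  apply: (dom _ _ (fun t y => k *: D t y)); first exact/Cw_Z/Cw_IDelta.
  split; [by []|exact: inHZ|move=> x Ox].
  by apply: le_trans (le0 x Ox); rewrite lee_fin IDeltaZ IDelta0; lra.
- move=> phi g Ephi Cg gc.
  have Cphi : Cw (lift_sum phi) by apply: Cw_lift_sum => t; exact: hEC.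
  (* With the shift [h = phi - g], hedging [c + h] by [phi] amounts to [g <= c]. *)
  rewrite -LB//; apply: (dom _ _ (fun _ _ => 0)); first exact: Cw_B.
  split; [by []|exact: inH0|move=> x Ox].
  by apply: le_trans (gc x Ox); rewrite lee_fin IDelta0; lra.
Qed.

Lemma dual_attained : exists2 Q : probability (BorelPath R d T) R, Mart K Q &
  (\int[Q]_(x in Om) c x + \sum_(t < T.+1) Dt E S t (marginal Q t) <= p%:E)%E.
Proof.
have [L [Llin Lpos L1 LI Ldual]] := superhedging_price_functional.
have C0 := Cw_cst K 0.
have L0 : L (fun=> 0) = 0.
  have := Llin (-1) _ _ C0 C0.
  by under eq_fun do rewrite mulr0 addr0; rewrite mulN1r addNr.
have LZ k u : Cw u -> L (fun x => k * u x) = k * L u.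
  move=> Cu; have := Llin k _ _ Cu C0.
  by under eq_fun do rewrite addr0; rewrite L0 addr0.
pose g0 (x : M) := - A * weight x.
have Cg0 : Cw g0 by apply: Cw_Z; exact: Cw_weight.
have Ltight e : 0 < e -> exists (B : set M) (F : M -> R),
    [/\ compact B /\ B `<=` Om, Cw F, forall x, Om x -> 0 <= F x,
      forall x, Om x -> ~ B x -> weight x <= F x & L F < e].
  move=> e0; pose a := `|p - L g0|.
  (* Tested at [- G f^n] and [g0], the price inequality reads [G L(F n) <= V(G f^n) + p - L g0].
     Once [V(G f^n) < 1] the right side is below [a + 2], whence [L(F n) < e]. *)
  pose G := (a + 2) / e.
  have G0 : 0 < G by rewrite divr_gt0// ltr_wpDl ?normr_ge0.
  have [n Vn] : exists n, Vfun S (fun t v => G * f t n v) < 1.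
    have /cvgrPdist_lt/(_ _ ltr01)[n _ /(_ n (leqnn n))] := hVf G0.
    rewrite /= sub0r normrN => /(le_lt_trans (ler_norm _)) Vn.
    by exists n.
  exists (B n), (F n); split; [by []|exact: CF|exact: F0|exact: weight_le_F|].
  have := Ldual (fun t v => - G * f t n v) g0 _ Cg0 cA.
  have -> : lift_sum (fun t v => - G * f t n v) = (fun x => - G * F n x).
    by apply/funext => x; exact: lift_sumZ.
  rewrite LZ//.
  have -> : Ufun S (fun t v => - G * f t n v) = - Vfun S (fun t v => G * f t n v).
    rewrite /Vfun opprK; congr (Ufun S); apply: functional_extensionality_dep => t.
    by apply/funext => v; rewrite mulNr.
  move=> H.
  have {}H : - Vfun S (fun t v => G * f t n v) - p <= - G * L (F n) - L g0.
    by apply: H => t; apply: hEscale; have [_ [_ []]] := hKf t n.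
  have : G * L (F n) < a + 2.
    have := ler_norm (p - L g0); rewrite -/a; lra.
  by rewrite /G mulrAC ltr_pdivrMr// ltr_pM2l// ltr_wpDl ?normr_ge0.
have [Q [Q1 Qint QL]] := riesz_representation hK Llin Lpos L1 Ltight.
have mOm := measurable_Omega hK.
have QM : Mart K Q.
  split; first by split => // t j; exact: (Qint _ (Cw_coord K t j)).
  by move=> D HD; rewrite (QL _ (Cw_IDelta HD)) LI.
exists Q => //.
have Cphi t (phi : Kpt K t -> R) : E t phi -> Cw (fun x => ext phi (row t x)).
  by move=> Ep; apply: Cw_ext; exact: hEC.
have Lsum phi : (forall t, E t (phi t)) ->
    L (lift_sum phi) = \sum_t L (fun x => ext (phi t) (row t x)).
  move=> Ephi; pose e t x := ext (phi t) (row t x).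
  suff [] : Cw (fun x => \sum_t e t x) /\ L (fun x => \sum_t e t x) = \sum_t L (e t) by [].
  elim: (index_enum _) => [|t s [CIH IH]].
    by under eq_fun do rewrite big_nil; rewrite big_nil.
  have Ce : Cw (e t) by exact: Cphi.
  under eq_fun do rewrite big_cons.
  split; first exact: Cw_D.
  have := Llin 1 _ _ Ce CIH; rewrite IH big_cons mul1r => <-.
  by congr L; apply/funext => x; rewrite mul1r.
have intc phi : (forall t, E t (phi t)) -> (\int[Q]_(x in Om) c x <=
    (p - \sum_t (S t (phi t) - L (fun x => ext (phi t) (row t x))))%:E)%E.
  move=> Ephi; apply: (integral_lsc_le hK hc cA Qint) => g Cg gc.
  rewrite QL// lee_fin sumrB -Lsum//.
  by have := Ldual phi g Ephi Cg gc; rewrite /Ufun; lra.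
have cge : ((L g0)%:E <= \int[Q]_(x in Om) c x)%E.
  rewrite -QL//; apply: le_integral_measurable => //.
    by have /integrableP[] := Qint _ Cg0.
  exact: measurable_fun_lsc_on.
(* The expected cost is bounded below by [L g0] and above by the estimate at [phi = 0]. Being
   finite, it can be moved across before the joint supremum is split into penalties. *)
have [r rE] : exists r, (\int[Q]_(x in Om) c x = r%:E)%E.
  move: cge (intc (fun _ _ => 0) hE0).
  by case: (\int[Q]_(x in Om) c x)%E => [r| |]//; exists r.
rewrite rE addeC -leeBrDr// -EFinB.
have -> : (\sum_(t < T.+1) Dt E S t (marginal Q t))%E = (\sum_(t < T.+1)
    ereal_sup [set (S t phi - L (fun x => ext phi (row t x)))%:E | phi in E t])%E.
  apply: eq_bigr => t _; rewrite /Dt; congr ereal_sup.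
  apply: eq_imagel => phi Ep; rewrite (integral_marginal hK Q1 (hEC Ep)).
    by rewrite QL//; exact: Cphi.
  exact: (Qint _ (Cphi _ _ Ep)).
apply: (sum_ereal_sup_le (x0 := fun t _ => 0)) => // phi Ephi.
by have := intc phi Ephi; rewrite rE lee_fin; lra.
Qed.

End duality.

Unset Implicit Arguments.

Theorem theorem3p4 (R : realType) (d T : nat) (hd : (0 < d)%N) (hT : (0 < T)%N)
  (K : 'I_T.+1 -> 'I_d -> set R)
  (hK : forall t j, closed (K t j))
  (E : forall t : 'I_T.+1, set (Kpt K t -> R))
  (S : forall t : 'I_T.+1, (Kpt K t -> R) -> R)
  (* E_t is a vector subspace of C_t *)
  (hEC : forall t phi, E t phi -> inC phi)
  (hE0 : forall t, E t (fun _ => 0))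
  (hEadd : forall t phi psi, E t phi -> E t psi -> E t (fun v => phi v + psi v))
  (hEscale : forall t (a : R) phi, E t phi -> E t (fun v => a * phi v))
  (* E_t + R = E_t *)
  (hEcst : forall t phi (k : R), E t phi -> E t (fun v => phi v + k))
  (* E_t contains the coordinate maps *)
  (hEcoord : forall t (j : 'I_d), E t (fun v => (sval v) ord0 j))
  (* S_t concave, cash additive, S_t(0) = 0 *)
  (hSconc : forall t phi psi (l : R), E t phi -> E t psi -> 0 <= l <= 1 ->
     l * S t phi + (1 - l) * S t psi <= S t (fun v => l * phi v + (1 - l) * psi v))
  (hScash : forall t phi (k : R), E t phi -> S t (fun v => phi v + k) = S t phi + k)
  (hS0 : forall t, S t (fun _ => 0) = 0)
  (* the growth / tightness condition *)
  (hgrowth : exists (KK : 'I_T.+1 -> nat -> set 'rV[R]_d)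
                    (f : forall t : 'I_T.+1, nat -> Kpt K t -> R),
      (forall t n, compact (KK t n) /\ KK t n `<=` Kt K t /\
                   E t (f t n) /\ forall v, 0 <= f t n v) /\
      (forall n x (hx : Omega K x), ~ (forall t, KK t n (row t x)) ->
         1 + \sum_(t < T.+1) \sum_(j < d) `|x t j|
           <= \sum_(t < T.+1) f t n (exist _ (row t x) (hx t))) /\
      (forall Gamma : R, 0 < Gamma ->
         (fun n => Vfun S (fun t v => Gamma * f t n v)) @ \oo --> 0))
  (c : 'M[R]_(T.+1, d) -> \bar R)
  (hc : lsc_on (Omega K) c)
  (hcA : exists A : R, 0 <= A /\ forall x, Omega K x ->
     ((- A * (1 + \sum_(t < T.+1) \sum_(j < d) `|x t j|))%:E <= c x)%E) :
  let primal :=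
    ereal_sup [set (Ufun S phi)%:E | phi in
      [set phi : forall t : 'I_T.+1, Kpt K t -> R |
        (forall t, E t (phi t)) /\
        exists Delta, inH K Delta /\
          forall x (hx : Omega K x),
            ((\sum_(t < T.+1) phi t (exist _ (row t x) (hx t))
              + IDelta Delta x)%:E <= c x)%E]] in
  let dual_obj := fun Q : probability (BorelPath R d T) R =>
    (\int[Q]_(x in Omega K) c x
      + \sum_(t < T.+1) Dt E S t (marginal Q t))%E in
  let dual := ereal_inf [set dual_obj Q | Q in Mart K] in
  primal = dual /\
  ((primal < +oo)%E -> exists2 Q, Mart K Q & dual_obj Q = dual).
Proof.
move=> primal dual_obj dual.
have [KK [f [hKf [hgr hVf]]]] := hgrowth.
have [A [A0 cA]] := hcA.
have primalE : primal = ereal_sup [set (Ufun S phi)%:E | phi in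
    [set phi | exists Delta, superhedge E c phi Delta (fun=> 0)]].
  congr ereal_sup; apply/seteqP; split => u [phi].
    move=> [Ephi [D [HD le_c]]] <-; exists phi => //; exists D; split => // x Ox.
    by rewrite subr0 (lift_sumE _ Ox).
  move=> [D [Ephi HD le_c]] <-; exists phi => //; split => //; exists D; split => // x Ox.
  by have := le_c x Ox; rewrite subr0 (lift_sumE _ Ox).
have primal_le_dual : (primal <= dual)%E.
  rewrite primalE; apply: ge_ereal_sup => _ [phi [D sp] <-].
  apply: le_ereal_inf_tmp => _ [Q QM <-].
  exact: (weak_duality hK S hEC hc sp QM).
have attained : (primal < +oo)%E ->
    exists2 Q, Mart K Q & (dual_obj Q <= primal)%E.
  move=> primal_fin.
  have [phi0 sp0] := superhedge_exists hEscale hEcst hKf hgr A0 cA (Cw_cst K 0).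
  (* The hedge [phi0] of [c] excludes the value [-oo]. *)
  have [p pE] : exists p, primal = p%:E.
    have : ((Ufun S phi0)%:E <= primal)%E.
      by rewrite primalE; apply: ereal_sup_ubound; exists phi0 => //; exists (fun _ _ => 0).
    by move: primal_fin; case: (primal) => [p| |]//; exists p.
  rewrite pE; apply: (dual_attained hK hEC hc hE0 hEadd hEscale hEcst hSconc
    hScash hKf hgr hVf A0 cA).
  move=> phi D sp; rewrite -lee_fin -pE primalE.
  by apply: ereal_sup_ubound; exists phi => //; exists D.
have dual_le Q : Mart K Q -> (dual <= dual_obj Q)%E.
  by move=> QM; apply: ereal_inf_lbound; exists Q.
split.
  apply/eqP; rewrite eq_le primal_le_dual/=.
  have [->|primal_fin] := eqVneq primal +oo%E; first by rewrite leey.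
  have [|Q QM Qle] := attained; first by rewrite ltey.
  exact: le_trans (dual_le Q QM) Qle.
move=> /attained[Q QM Qle]; exists Q => //.
apply/eqP; rewrite eq_le dual_le// andbT.
exact: le_trans Qle primal_le_dual.
Qed.
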